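(* Let $G$ be a graph. The following statements are equivalent: (i) $G$ has a vital linkage of order $2$; (ii) $G$ has a chordless spanning linkage $L$ of order $2$ such that $G$ has no $\mathit{XX}$ linkage minor with respect to $L$; (iii) $G$ is a Truemper graph.
   Context: A linkage in a graph $G$ is a subgraph each of whose components is a path; its order is the number of components. A linkage $L$ of order $k$ is unique if no other collection of $k$ vertex-disjoint paths connects the same pairs of end vertices (terminals), spanning if $V(L)=V(G)$, and vital if it is both unique and spanning. Given a spanning linkage $L$ of $G$, edges of $L$ are path edges; an edge of $E(G)\setminus E(L)$ is a chord if both its endpoints lie in the same component of $L$, and a rung edge otherwise. $L$ is chordless if $G$ has no chords. For a chordless linkage $L$ of $G$, a linkage minor of $G$ (with respect to $L$) is a minor $H$ of $G$ such that every path edge in $E(G)\setminus E(H)$ has been contracted and every rung edge in $E(G)\setminus E(H)$ has been deleted; $H$ carries the linkage that is the image of $L$. If $L$ has order 2, $G$ has an $\mathit{XX}$ linkage minor (with respect to $L$) if $G$ has a linkage minor isomorphic to $K_{2,4}$ in which the four terminal vertices of $L$ are mapped to the four degree-2 vertices of $K_{2,4}$. For an integer $n$, $\ddot{U}_n$ is the graph with vertex set $\{v_1,\dots,v_n\}\cup\{u_1,\dots,u_n\}$ and edge set $\{v_iv_{i+1}: 1\le i\le n-1\}\cup\{u_iu_{i+1}:1\le i\le n-1\}\cup\{u_iv_i:1\le i\le n\}\cup\{u_iv_{n+1-i}:1\le i\le n\}$; $L_n$ is the linkage of $\ddot{U}_n$ consisting of the edges $v_iv_{i+1}$ and $u_iu_{i+1}$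 for $1\le i\le n-1$. A graph $G$ is a Truemper graph if $G$ is a linkage minor of $\ddot{U}_n$ with respect to $L_n$ for some $n$. *)

(* Defs.v *)
From mathcomp Require Import all_boot.

Set Implicit Arguments.
Unset Strict Implicit.
Unset Printing Implicit Defensive.

Record sgraph := SGraph {
  vertex :> finType;
  adj : rel vertex;
  adj_sym : symmetric adj;
  adj_irr : irreflexive adj
}.

Section Linkages.
Variable G : sgraph.
Implicit Types (L : seq (seq G)) (p : seq G) (e : {set G}).

Definition edges : {set {set G}} :=
  [set [set z.1; z.2] | z : G * G & adj z.1 z.2].

Definition degree (x : G) : nat := #|[set y | adj x y]|.

(* A linkage is given by the list of its components, each component being the
   list of its vertices in path order; a single vertex is a path.  The order
   of the linkage is the length of the list.  Different lists may describe the
   same linkage: as a subgraph it is the pair (lverts L, ledges L). *)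
Definition linkage L : bool :=
  all (fun p => (p != [::]) && sorted (@adj G) p) L && uniq (flatten L).

Definition lverts L : {set G} := [set x in flatten L].

Definition ledges L : {set {set G}} :=
  \bigcup_(p <- L) [set [set z.1; z.2] | z in zip p (behead p)].

(* The pair of ends of a path, as an unordered pair; it is a singleton for a
   path with a single vertex. *)
Definition path_ends p : {set G} :=
  if p is x :: s then [set x; last x s] else set0.

Definition terminals L : {set G} := \bigcup_(p <- L) path_ends p.

Definition unique_linkage L : Prop :=
  forall L', linkage L' ->
    perm_eq [seq path_ends p | p <- L'] [seq path_ends p | p <- L] ->
    lverts L' = lverts L /\ ledges L' = ledges L.

Definition spanning L : Prop := lverts L = [set: G].

Definition vital L : Prop := unique_linkage L /\ spanning L.

Definition chords L : {set {set G}} :=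
  [set e in edges :\: ledges L | has (fun p => e \subset p) L].

Definition rungs L : {set {set G}} := (edges :\: ledges L) :\: chords L.

Definition chordless L : Prop := chords L = set0.

(* For a chordless spanning linkage L, [linkage_minor L phi] says that H is
   (isomorphic to) the graph obtained from G by contracting the set C of path
   edges and deleting the set D of rung edges, where phi sends each vertex of G
   to the vertex of H it is contracted to.  Rung edges that become parallel
   are identified, which amounts to deleting all but one of them; no edge
   becomes a loop, and none becomes parallel to a path edge. *)
Definition linkage_minor L (H : sgraph) (phi : G -> H) : Prop :=
  exists C D : {set {set G}},
    [/\ C \subset ledges L /\ D \subset rungs L,
        forall h : H, exists x : G, phi x = h,
        forall x y : G,
          phi x = phi y <-> connect (fun a b => [set a; b] \in C) x y
      & forall h k : H,
          adj h k <-> exists x y : G,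
            [/\ phi x = h, phi y = k & [set x; y] \in edges :\: (C :|: D)]].

End Linkages.

Section CompleteBipartite.
Variables m n : nat.

Definition Kmn_adj (x y : 'I_m + 'I_n) : bool :=
  match x, y with
  | inl _, inr _ | inr _, inl _ => true
  | _, _ => false
  end.

Lemma Kmn_sym : symmetric Kmn_adj.
Proof. by case=> i [] j. Qed.

Lemma Kmn_irr : irreflexive Kmn_adj.
Proof. by case. Qed.

Definition complete_bipartite : sgraph := SGraph Kmn_sym Kmn_irr.

End CompleteBipartite.

(* Since K_{2,4} has four vertices of degree 2, the equality forces L to have
   four distinct terminals when it has order 2. *)
Definition has_XX (G : sgraph) (L : seq (seq G)) : Prop :=
  exists phi : G -> complete_bipartite 2 4,
    linkage_minor L phi /\
    phi @: terminals L = [set h : complete_bipartite 2 4 | degree h == 2].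

Section DoubleU.
Variable n : nat.

(* With indices starting from 0, inl i is v_(i+1), inr i is u_(i+1), and
   rev_ord sends the index of v_i to that of v_(n+1-i). *)
Definition Udd_adj (x y : 'I_n + 'I_n) : bool :=
  match x, y with
  | inl i, inl j | inr i, inr j => (i.+1 == j :> nat) || (j.+1 == i :> nat)
  | inl j, inr i | inr i, inl j => (j == i) || (j == rev_ord i)
  end.

Lemma Udd_sym : symmetric Udd_adj.
Proof. by case=> i [] j //=; rewrite orbC. Qed.

Lemma Udd_irr : irreflexive Udd_adj.
Proof. by case=> i /=; rewrite orbb gtn_eqF. Qed.

Definition Udd : sgraph := SGraph Udd_sym Udd_irr.

Definition Udd_linkage : seq (seq Udd) :=
  [:: [seq inl i | i <- enum 'I_n]; [seq inr i | i <- enum 'I_n]].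

End DoubleU.

(* For n = 0 the graph is empty and its linkage does not have order 2. *)
Definition Truemper (G : sgraph) : Prop :=
  exists n : nat, 0 < n /\
    exists phi : Udd n -> G, linkage_minor (Udd_linkage n) phi.

(* Main.v *)
(** In a chordless spanning linkage with components P and Q, an XX linkage minor is
    the same thing as a crossing: rungs x1 y2, x4 y3, x2 y1, x3 y4 with
    x1 < {x2, x3} < x4 along P and y1 < {y2, y3} < y4 along Q.

    - A vital linkage has no chord, which would shortcut a path, and no crossing,
      since the pieces x1-y2-..-y3-x4 and y1-x2-..-x3-y4 reroute the linkage.
    - Conversely, let P', Q' be other disjoint paths with the same ends.  If P' is
      inside P, it is P.  Otherwise the first and the last departure of P' from P,
      together with those of Q' from Q, form a crossing, because up to its first
      departure P' runs through an initial segment of P.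
    - Without crossing, shrink intervals [a, b] of P and [c, d] of Q from the full
      paths: an end with no rung into the open interval opposite can move inwards,
      and if all four ends have such rungs there is a crossing.  The successive
      intervals spell out P, Q and their rungs as a linkage minor of Udd n.
    - In Udd n, the rungs preserve the distance to the middle.  In a crossing, x1 or
      x4 is strictly further out than x2 and x3, and likewise for y; so no crossing
      exists there, and crossings of a linkage minor lift. *)

Require Import Defs.
From mathcomp Require Import all_boot zify.

Set Implicit Arguments.
Unset Strict Implicit.
Unset Printing Implicit Defensive.

(** * Consecutive pairs of a list *)

Lemma eq_set2 (T : finType) (x y u v : T) :
  [set x; y] = [set u; v] -> (x = u /\ y = v) \/ (x = v /\ y = u).
Proof.
move=> /setP H.
have := H x; have := H y; have := H u; have := H v; rewrite !inE !eqxx !orbT /=.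
by move=> /orP[] /eqP ? /orP[] /eqP ? /esym/orP[] /eqP ? /esym/orP[] /eqP ?; subst; auto.
Qed.

Lemma mem_zip_beheadP (T : eqType) (p : seq T) (x y : T) :
  reflect (exists s1 s2, p = s1 ++ x :: y :: s2) ((x, y) \in zip p (behead p)).
Proof.
apply: (iffP idP); last first.
  move=> [s1 [s2 ->]]; elim: s1 => [|a s1 IH] /=; first by rewrite inE eqxx.
  by case: s1 IH => [|b s1] /= IH; rewrite inE IH orbT.
elim: p => [|a [|b p] IH] //=; rewrite inE => /orP[/eqP[-> ->]|/IH].
  by exists [::], p.
by move=> [s1 [s2 ->]]; exists (a :: s1), s2.
Qed.

Lemma mem_zip_behead (T : eqType) (p : seq T) (x y : T) : uniq p ->
  ((x, y) \in zip p (behead p)) =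
  [&& x \in p, y \in p & (index x p).+1 == index y p].
Proof.
move=> up; apply/mem_zip_beheadP/and3P => [[s1 [s2 ep]]|[xp yp /eqP ixy]].
  have := up; rewrite ep cat_uniq /= !inE !negb_or.
  move=> /and3P[_ /and3P[xs ys _] /and3P[/andP[xy _] _ _]].
  rewrite !mem_cat !inE !eqxx !orbT !index_cat (negPf xs) (negPf ys) /=.
  by rewrite !eqxx (negPf xy) addn0 addn1.
have lp : index y p < size p by rewrite index_mem.
exists (take (index x p) p), (drop (index y p).+1 p).
rewrite -{1}(cat_take_drop (index x p) p); congr (_ ++ _).
rewrite (drop_nth x) ?index_mem // nth_index // ixy; congr (_ :: _).
by rewrite (drop_nth x) // nth_index.
Qed.

Lemma mem_zip_rev (T : eqType) (p : seq T) (x y : T) :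
  ((x, y) \in zip (rev p) (behead (rev p))) = ((y, x) \in zip p (behead p)).
Proof.
have rr (q : seq T) u v : (u, v) \in zip q (behead q) ->
    (v, u) \in zip (rev q) (behead (rev q)).
  move=> /mem_zip_beheadP[s1 [s2 ->]]; apply/mem_zip_beheadP.
  by exists (rev s2), (rev s1); rewrite rev_cat !rev_cons !cat_rcons.
by apply/idP/idP => /rr //; rewrite revK.
Qed.

Lemma sorted_zip (T : eqType) (e : rel T) (p : seq T) :
  sorted e p <-> forall x y, (x, y) \in zip p (behead p) -> e x y.
Proof.
elim: p => [|a [|b p] IH] //=; split.
  move=> /andP[ab pp] x y; rewrite inE => /orP[/eqP[-> ->] //|].
  by move: x y; apply/IH.
move=> H; rewrite H ?inE ?eqxx //=.
by apply/IH => x y xy; apply: H; rewrite inE xy orbT.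
Qed.

(** * Edges of two-path linkages under swapping and reversal *)

Section Basics.
Variable G : sgraph.

Lemma mem_edges (x y : G) : ([set x; y] \in edges G) = adj x y.
Proof.
apply/imsetP/idP => [[[u v] + +]|xy]; last by exists (x, y); rewrite ?inE.
rewrite inE /= => uv /eq_set2[[-> ->]|[-> ->]] //; by rewrite adj_sym.
Qed.

Lemma edgeP (e : {set G}) : e \in edges G -> exists x y : G, adj x y /\ e = [set x; y].
Proof. by move=> /imsetP[[x y]]; rewrite inE => xy ->; exists x, y. Qed.

Lemma ledgeP (P Q : seq G) (e : {set G}) :
  reflect (exists x y, e = [set x; y] /\
     ((x, y) \in zip P (behead P) \/ (x, y) \in zip Q (behead Q)))
    (e \in ledges [:: P; Q]).
Proof.
rewrite /ledges !big_cons big_nil setU0 inE; apply: (iffP orP).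
  by case=> /imsetP[[x y] xy ->]; exists x, y; split => //; [left|right].
by move=> [x [y [-> [xy|xy]]]]; [left|right]; apply/imsetP; exists (x, y).
Qed.

Lemma ledges_swap (P Q : seq G) : ledges [:: P; Q] = ledges [:: Q; P].
Proof. by rewrite /ledges !big_cons !big_nil !setU0 setUC. Qed.

Lemma lverts_swap (P Q : seq G) : lverts [:: P; Q] = lverts [:: Q; P].
Proof. by apply/setP => x; rewrite !inE /= !cats0 !mem_cat orbC. Qed.

Lemma linkage_swap (P Q : seq G) : linkage [:: P; Q] = linkage [:: Q; P].
Proof. by rewrite /linkage /= !cats0 uniq_catC !andbT (andbC (_ && _) (_ && sorted _ Q)). Qed.

Lemma linkage_rev (P Q : seq G) : linkage [:: P; Q] -> linkage [:: rev P; Q].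
Proof.
rewrite /linkage /= !cats0 !andbT => /andP[/andP[/andP[P0 sP] ->] uPQ].
rewrite rev_sorted -size_eq0 size_rev size_eq0 P0 /=.
rewrite (eq_sorted (e' := @adj G)) ?sP => [|x y]; last exact: adj_sym.
by rewrite -(@perm_uniq _ (P ++ Q)) // perm_cat2r perm_sym perm_rev.
Qed.

Lemma ledges_rev (P Q : seq G) : ledges [:: rev P; Q] = ledges [:: P; Q].
Proof.
apply/setP => e; apply/ledgeP/ledgeP => -[x [y [-> [H|H]]]].
- by exists y, x; rewrite setUC -mem_zip_rev; auto.
- by exists x, y; auto.
- by exists y, x; rewrite setUC mem_zip_rev; auto.
- by exists x, y; auto.
Qed.

Lemma lverts_rev (P Q : seq G) : lverts [:: rev P; Q] = lverts [:: P; Q].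
Proof. by apply/setP => x; rewrite !inE /= !mem_cat mem_rev. Qed.

End Basics.

(** * Positions on the two paths, and linkage minors as interval maps *)

Section TwoPaths.
Variables (G : sgraph) (P Q : seq G).

Definition same_path (x y : G) := (x \in P) == (y \in P).
(** The second branch is meant for the vertices of [Q]: by [in_Q], these are the vertices off [P]
    once the linkage is spanning. *)
Definition pos (x : G) := if x \in P then index x P else index x Q.
(** These are the path edges, by [mem_ledges]; stated through positions, they turn path arguments
    into arithmetic. *)
Definition consec (x y : G) :=
  same_path x y && (((pos x).+1 == pos y) || ((pos y).+1 == pos x)).

Hypothesis lPQ : linkage [:: P; Q].
Hypothesis sPQ : spanning [:: P; Q].

Lemma linkage2 : [/\ P != [::], Q != [::], uniq P & uniq Q].
Proof.
have := lPQ; rewrite /linkage /= !cats0 cat_uniq.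
by by case/andP=> /and3P[/andP[-> _] /andP[-> _] _] /and3P[-> _ ->].
Qed.

Lemma in_Q x : (x \in Q) = (x \notin P).
Proof.
have := lPQ; rewrite /linkage /= !cats0 cat_uniq.
case/andP=> _ /and3P[_ /hasPn H _].
have : x \in lverts [:: P; Q] by rewrite sPQ inE.
rewrite inE /= cats0 mem_cat.
case: (boolP (x \in Q)) => [/H -> //|_].
by rewrite orbF => ->.
Qed.

Lemma pos_inj x y : same_path x y -> pos x = pos y -> x = y.
Proof.
rewrite /same_path /pos => /eqP; have := in_Q x; have := in_Q y.
by case: ifP => xP; case: ifP => // yP xQ yQ _; apply: (@index_inj _ x);
  rewrite ?xP ?xQ ?yP ?yQ.
Qed.

Lemma pos_onto x k : k <= pos x -> exists2 z, same_path x z & pos z = k.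
Proof.
have [_ _ uP uQ] := linkage2; have := in_Q x; rewrite /same_path /pos.
case: ifP => xP; rewrite /= -index_mem => xQ kx.
  have kP : k < size P by rewrite (leq_ltn_trans kx) // index_mem.
  by exists (nth x P k); rewrite mem_nth // index_uniq.
have kQ : k < size Q by rewrite (leq_ltn_trans kx) // xQ.
have : nth x Q k \in Q by rewrite mem_nth.
rewrite in_Q => nP; exists (nth x Q k); first by rewrite (negPf nP).
by rewrite (negPf nP) index_uniq.
Qed.

Lemma mem_ledges x y : ([set x; y] \in ledges [:: P; Q]) = consec x y.
Proof.
have [_ _ uP uQ] := linkage2.
have cs u v : consec u v = consec v u by rewrite /consec /same_path eq_sym orbC.
have E u v : ((u, v) \in zip P (behead P)) || ((u, v) \in zip Q (behead Q)) =
    same_path u v && ((pos u).+1 == pos v).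
  rewrite !mem_zip_behead // !in_Q /same_path /pos.
  by case: ifP => uP'; case: ifP => vP' //=; rewrite orbF.
apply/ledgeP/idP => [[u [v [/eq_set2 H /orP]]]|].
  rewrite E => /andP[uv /eqP pp].
  suff : consec u v by case: H => [] [-> ->] //; rewrite cs.
  by rewrite /consec uv pp eqxx.
move=> /andP[xy /orP[pp|pp]]; [exists x, y|exists y, x; rewrite setUC];
  split=> //; apply/orP; rewrite E.
  by rewrite xy.
by rewrite /same_path eq_sym pp andbT.
Qed.

Lemma consec_adj x y : consec x y -> adj x y.
Proof.
rewrite -mem_ledges => /ledgeP[u [v [/eq_set2 H uv]]].
suff : adj u v by case: H => [] [-> ->] //; rewrite adj_sym.
have := lPQ; rewrite /linkage /= !cats0 => /andP[/and3P[/andP[_ sP] /andP[_ sQ] _] _].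
by case: uv; apply: (@sorted_zip _ _ _).1.
Qed.

Definition no_chord := forall x y : G, adj x y -> same_path x y -> consec x y.

Lemma subset_path x y : (has (fun p => [set x; y] \subset p) [:: P; Q]) = same_path x y.
Proof.
have E (p : seq G) : ([set x; y] \subset p) = (x \in p) && (y \in p).
  apply/subsetP/andP => [H|[xp yp] z]; last by rewrite !inE => /orP[] /eqP ->.
  by split; apply: H; rewrite !inE eqxx ?orbT.
rewrite /= !E !in_Q /same_path orbF.
by case: (x \in P) (y \in P) => [] [].
Qed.

Lemma chordlessP : chordless [:: P; Q] <-> no_chord.
Proof.
split=> [/setP H x y xy sxy|H].
  have := H [set x; y]; rewrite inE in_set0 subset_path sxy andbT inE mem_edges xy andbT.
  by rewrite mem_ledges => /negbFE.
apply/setP => e; rewrite inE in_set0; apply/negP => /andP[].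
rewrite inE => /andP[+ /edgeP[x [y [xy ee]]]]; subst e.
by rewrite subset_path mem_ledges => /negP nc /(H _ _ xy).
Qed.

Lemma mem_rungs x y : no_chord ->
  ([set x; y] \in rungs [:: P; Q]) = adj x y && ~~ same_path x y.
Proof.
move=> H; rewrite /rungs (chordlessP.2 H) setD0 inE mem_ledges mem_edges andbC.
case: (boolP (adj x y)) => //= xy; congr negb; apply/idP/idP; last exact: H.
by case/andP.
Qed.

(* By linkage_minorP, the linkage minors, with the contracted and deleted edge
   sets eliminated: the fibres of phi are intervals of one path. *)
Definition coarse (H : sgraph) (phi : G -> H) :=
  [/\ forall h, exists x, phi x = h,
      forall x y z, phi x = phi y ->
        same_path x y /\
        (same_path x z -> pos x <= pos z <= pos y -> phi z = phi x),
      forall x y, consec x y -> phi x = phi y \/ adj (phi x) (phi y)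
    & forall h k, adj h k -> exists x y, [/\ phi x = h, phi y = k & adj x y]].

Lemma same_pathT : transitive same_path.
Proof. by move=> y x z /eqP xy /eqP yz; apply/eqP; rewrite xy. Qed.

Lemma same_pathC : symmetric same_path.
Proof. by move=> x y; rewrite /same_path eq_sym. Qed.

(** A chain of contracted edges moves by one position at a time on one path, so it meets every
    position between its ends, and fibres are intervals. Conversely, the image determines a possible
    choice of contracted and deleted edges. *)
Lemma linkage_minorP (H : sgraph) (phi : G -> H) : no_chord ->
  linkage_minor [:: P; Q] phi <-> coarse phi.
Proof.
move=> nc; split.
  move=> [C [D [[/subsetP CL /subsetP DR] surj fib adjE]]].
  have Cc x y : [set x; y] \in C -> consec x y by rewrite -mem_ledges; apply: CL.
  split=> //.
  - move=> x y z /fib/connectP[p pp ->].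
    (* Either [z] has the position of [x] and equals it, or the next vertex [w] of the chain is
       still not beyond [z]. *)
    elim: p x pp => [|w p IH] x /=.
      move=> _; split; first exact: eqxx.
      by move=> xz ?; congr phi; apply: pos_inj; [rewrite same_pathC | lia].
    move=> /andP[xw pp]; have /andP[sxw xwp] := Cc _ _ xw.
    have exw : phi x = phi w by apply/fib/connect1.
    have [sw cw] := IH _ pp; split; first exact: same_pathT sw.
    move=> sxz lz; have swz : same_path w z by apply: same_pathT sxz; rewrite same_pathC.
    rewrite exw.
    have [xz|xz] := eqVneq (pos z) (pos x).
      by rewrite -exw; congr phi; apply: pos_inj; rewrite // same_pathC.
    by apply: cw => //; lia.
  - move=> x y cxy; have [?|nxy] := eqVneq (phi x) (phi y); [by left|right].
    apply/adjE; exists x, y; split=> //; rewrite !inE mem_edges consec_adj // andbT negb_or.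
    apply/andP; split; apply/negP.
      by move=> xy; case/eqP: nxy; apply/fib/connect1.
    by move=> /DR; rewrite mem_rungs //; case/andP: cxy => ->; rewrite andbF.
  - move=> h k /adjE[x [y [hx ky]]]; rewrite inE mem_edges => /andP[_ xy].
    by exists x, y.
move=> [surj fib cons adjE].
(* Contract the path edges inside a fibre, and delete the rungs whose ends have nonadjacent
   images. *)
pose C := [set e in ledges [:: P; Q] |
  [forall x in e, forall y in e, phi x == phi y]].
pose D := [set e in rungs [:: P; Q] | [forall x, forall y,
  (e == [set x; y]) ==> ~~ adj (phi x) (phi y)]].
have CE x y : ([set x; y] \in C) = consec x y && (phi x == phi y).
  rewrite inE mem_ledges; congr (_ && _); apply/forall_inP/eqP => [/(_ x)|exy u ue].
    rewrite !inE eqxx => /(_ isT)/forall_inP/(_ y).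
    by rewrite !inE eqxx orbT => /(_ isT)/eqP.
  apply/forall_inP => v; move: ue; rewrite !inE.
  by move=> /orP[] /eqP -> /orP[] /eqP -> //; rewrite exy.
have DE x y : ([set x; y] \in D) =
    [&& adj x y, ~~ same_path x y & ~~ adj (phi x) (phi y)].
  rewrite inE mem_rungs // -andbA; do 2 congr (_ && _).
  apply/forallP/idP => [/(_ x)/forallP/(_ y)|nxy u]; first by rewrite eqxx.
  by apply/forallP => v; apply/implyP => /eqP/eq_set2[] [<- <-] //; rewrite adj_sym.
exists C, D; split=> //.
- by split; apply/subsetP => e; rewrite inE => /andP[].
- have Csym : connect_sym (fun a b : G => [set a; b] \in C).
    by apply: sym_connect_sym => a b /=; rewrite setUC.
  (* The successor [z] of [x] lies between [x] and [y], hence in the same fibre, so the edge from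
     [x] to [z] is contracted; induct on the distance to [y]. *)
  have le x y : pos x <= pos y -> phi x = phi y ->
      connect (fun a b => [set a; b] \in C) x y.
    move: {2}(pos y - pos x) (erefl (pos y - pos x)) => n.
    elim: n x => [|n IH] x d lxy exy; have [sxy cxy] := fib _ _ x exy.
      by rewrite (@pos_inj x y) //; lia.
    have lt : (pos x).+1 <= pos y by lia.
    have [z syz pz] := pos_onto lt.
    have sxz := same_pathT sxy syz.
    have exz : phi z = phi x by apply: (fib x y z exy).2 => //; lia.
    apply: (@connect_trans _ _ z); last by apply: IH; rewrite ?pz ?exz //; lia.
    by apply: connect1; rewrite CE exz eqxx /consec sxz pz eqxx.
  move=> x y; split => [exy|].
    by case: (leqP (pos x) (pos y)) => [|/ltnW] l; last rewrite Csym; apply: le.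
  move=> /connectP[p pp ->]; elim: p x pp => //= w p IH x /andP[].
  by rewrite CE => /andP[_ /eqP ->]; apply: IH.
- move=> h k; split => [hk|[x [y [<- <-]]]].
    have [x [y [ex ey xy]]] := adjE _ _ hk; exists x, y; split=> //.
    rewrite in_setD in_setU mem_edges xy andbT CE DE ex ey hk /= !andbF orbF.
    by apply/negP => /andP[_ /eqP hk']; move: hk; rewrite hk' adj_irr.
  rewrite in_setD in_setU mem_edges CE DE => /andP[+ xy].
  rewrite xy /=; have [sxy|//] := boolP (same_path x y); last by case: adj; rewrite ?orbT.
  have cxy := nc _ _ xy sxy; rewrite cxy /= orbF => /eqP nxy.
  by case: (cons _ _ cxy).
Qed.

End TwoPaths.

(** * Peeling two intervals from outside, and contracting a walk *)

Section Peel.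
Variable R : rel nat.

(** Repetition is allowed because neighbouring levels of [Udd n] may be contracted to the same
    vertex. *)
Definition step_le : rel nat := fun x y => x <= y <= x.+1.

(* Reading the levels of Udd n from the outside in, the four rungs at levels k and
   n - 1 - k join {f k, f (n - 1 - k)} to {g k, g (n - 1 - k)}, where f and g are
   the sequences a :: s and c :: t; so these are the pairs that must cover R. *)
Lemma peel a b c d : a <= b -> c <= d ->
  (forall i1 i2 i3 i4 j1 j2 j3 j4, a <= i1 -> i4 <= b -> c <= j1 -> j4 <= d ->
     i1 < i2 < i4 -> i1 < i3 < i4 -> j1 < j2 < j4 -> j1 < j3 < j4 ->
     R i1 j2 -> R i4 j3 -> R i2 j1 -> R i3 j4 -> False) ->
  exists s t : seq nat, [/\ size s = size t,
    path step_le a s /\ last a s = b,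
    path step_le c t /\ last c t = d &
    forall i j, a <= i <= b -> c <= j <= d -> R i j ->
      (i, j) \in zip (a :: s) (c :: t) ++ zip (a :: s) (rev (c :: t))].
Proof.
move: {2}(b - a + (d - c)) (erefl (b - a + (d - c))) => n.
elim/ltn_ind: n a b c d => n IH a b c d def_n ab cd noX.
(* One round: shrink to [a', b'] and [c', d'], provided every rung lost joins an end of [a, b] to an
   end of [c, d]. The old ends are put around the sequences of the smaller intervals; an end that
   did not move is simply repeated. *)
have grow a' b' c' d' : a <= a' <= a.+1 -> b' <= b <= b'.+1 -> a' <= b' ->
    c <= c' <= c.+1 -> d' <= d <= d'.+1 -> c' <= d' ->
    (b' - a') + (d' - c') < n ->
    (forall i j, a <= i <= b -> c <= j <= d -> R i j ->
       (a' <= i <= b') && (c' <= j <= d') ||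
       ((i == a) || (i == b)) && ((j == c) || (j == d))) ->
    exists s t : seq nat, [/\ size s = size t,
      path step_le a s /\ last a s = b,
      path step_le c t /\ last c t = d &
      forall i j, a <= i <= b -> c <= j <= d -> R i j ->
        (i, j) \in zip (a :: s) (c :: t) ++ zip (a :: s) (rev (c :: t))].
  move=> aa bb ab' cc dd cd' lt_n cov.
  have [|s [t [st [ps ls] [pt lt] covst]]] := IH _ lt_n a' b' c' d' erefl ab' cd'.
    move=> i1 i2 i3 i4 j1 j2 j3 j4 *.
    by apply: (noX i1 i2 i3 i4 j1 j2 j3 j4) => //; lia.
  exists (rcons (a' :: s) b), (rcons (c' :: t) d); split.
  - by rewrite !size_rcons /= st.
  - by rewrite last_rcons rcons_path /= ps ls /step_le; lia.
  - by rewrite last_rcons rcons_path /= pt lt /step_le; lia.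
  move=> i j ia jc Rij.
  have st' : size (a' :: s) = size (c' :: t) by rewrite /= st.
  (* The new outer layer adds (a, c) and (b, d) to the straight zip, and (a, d) and (b, c) to the
     reversed one: all four pairs of ends. *)
  have Z (u v : seq nat) x y z w : size u = size v ->
      zip (x :: rcons u y) (z :: rcons v w) = (x, z) :: rcons (zip u v) (y, w).
    by move=> uv /=; rewrite zip_rcons.
  have -> : rev (c :: rcons (c' :: t) d) = d :: rcons (rev (c' :: t)) c.
    by rewrite rev_cons rev_rcons.
  rewrite !Z ?size_rev // => {Z}.
  move: (zip (a' :: s) (c' :: t)) (zip (a' :: s) (rev (c' :: t))) covst => z1 z2 covst.
  have /orP[inn|out] := cov i j ia jc Rij.
    have := covst i j; rewrite !mem_cat => /(_ _ _ Rij); case/andP: inn => -> -> /(_ isT isT).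
    by rewrite !(inE, mem_rcons) /=; case/orP => ->; rewrite ?orbT.
  case/andP: out => /orP[] /eqP -> /orP[] /eqP ->;
    by rewrite !(inE, mem_cat, mem_rcons, eqxx, orbT).
(* If one interval is a single point, all its members are ends, so the other interval can lose an
   end. *)
have [eab|nab] := eqVneq a b.
  have [ecd|ncd] := eqVneq c d.
    exists [::], [::]; split=> // i j ia jc _.
    have -> : i = a by lia. have -> : j = c by lia.
    by rewrite inE eqxx.
  by apply: (grow a b c.+1 d) => //; try lia; move=> i j; lia.
have [ecd|ncd] := eqVneq c d.
  by apply: (grow a.+1 b c d) => //; try lia; move=> i j; lia.
(* The list [iota c.+1 (d - c.+1)] is the open interval between [c] and [d]. The four ends are
   tested in turn: one without a rung into the open interval opposite moves inwards, and four such
   rungs contradict [noX]. *)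
case: (boolP (has (R a) (iota c.+1 (d - c.+1)))) => [/hasP[j2 + Rj2]|/hasPn ha]; last first.
  apply: (grow a.+1 b c d) => //; try lia; move=> i j ia jc Rij.
  have [e|] := eqVneq i a; last lia.
  by have := ha j; rewrite mem_iota -e Rij /=; lia.
case: (boolP (has (R b) (iota c.+1 (d - c.+1)))) => [/hasP[j3 + Rj3]|/hasPn hb]; last first.
  move=> _; apply: (grow a b.-1 c d) => //; try lia; move=> i j ia jc Rij.
  have [e|] := eqVneq i b; last lia.
  by have := hb j; rewrite mem_iota -e Rij /=; lia.
case: (boolP (has (R^~ c) (iota a.+1 (b - a.+1)))) => [/hasP[i2 + Ri2]|/hasPn hc]; last first.
  move=> _ _; apply: (grow a b c.+1 d) => //; try lia; move=> i j ia jc Rij.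
  have [e|] := eqVneq j c; last lia.
  by have := hc i; rewrite mem_iota -e Rij /=; lia.
case: (boolP (has (R^~ d) (iota a.+1 (b - a.+1)))) => [/hasP[i3 + Ri3]|/hasPn hd]; last first.
  move=> _ _ _; apply: (grow a b c d.-1) => //; try lia; move=> i j ia jc Rij.
  have [e|] := eqVneq j d; last lia.
  by have := hd i; rewrite mem_iota -e Rij /=; lia.
rewrite !mem_iota => *.
by case: (noX a i2 i3 b c j2 j3 d) => //; lia.
Qed.

Lemma path_step_hit a s k : path step_le a s -> a <= k <= last a s -> k \in a :: s.
Proof.
elim: s a => [|b s IH] a /=; first by move=> _; rewrite inE; lia.
move=> /andP[ab pp] ak; rewrite inE; have [//|nk] := eqVneq k a.
by apply: IH => //; move: ab; rewrite /step_le; lia.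
Qed.

End Peel.

(** Dropping repetitions from the walk [f] leaves a path, since interval fibres forbid a return to
    an earlier vertex. This gives the image of a component of [Udd n] under a linkage minor. *)
Lemma contract (T : eqType) (e : rel T) (f : nat -> T) n :
  (forall i, i < n -> f i = f i.+1 \/ e (f i) (f i.+1)) ->
  (forall i j k, i <= j <= k -> k <= n -> f i = f k -> f j = f i) ->
  exists p : seq T, [/\ p != [::], sorted e p, uniq p,
    forall x, x \in p <-> exists2 i, i <= n & x = f i &
    (forall i j, i <= j <= n -> index (f i) p <= index (f j) p) /\
    (forall i, i < n -> index (f i.+1) p <= (index (f i) p).+1)].
Proof.
elim: n => [|n IH] st cv.
  exists [:: f 0]; split=> //.
    by move=> x; rewrite inE; split=> [/eqP ->|[[|i] // _ ->]//]; exists 0.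
  by split=> [[|i] [|j]|] // *; exfalso; lia.
have [|i j k ijk kn|p [p0 sp up mp [mono stp]]] := IH.
- by move=> i ln; apply: st; lia.
- by apply: cv => //; lia.
have fnp : f n \in p by apply/mp; exists n.
(* By monotonicity of the index, [f n] comes last in [p], so the next vertex can be appended after
   it. *)
have lastp : index (f n) p = (size p).-1.
  case/lastP: p p0 sp up mp mono stp fnp => // p y _ _ up mp mono _ _.
  have /mp[i le_in yi] : y \in rcons p y by rewrite mem_rcons inE eqxx.
  have := mono i n; rewrite le_in leqnn -yi => /(_ isT).
  move: up; rewrite rcons_uniq => /andP[yp up].
  have : f n \in rcons p y by apply/mp; exists n.
  rewrite -index_mem !size_rcons -cats1 !index_cat (negPf yp) /= eqxx; lia.
have [ef|nf] := eqVneq (f n) (f n.+1).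
  exists p; split=> //.
    move=> x; split=> [/mp[i li ->]|[i li ->]]; first by exists i => //; lia.
    have [->|ni] := eqVneq i n.+1; first by rewrite -ef.
    by apply/mp; exists i => //; lia.
  split=> [i j ij|i li].
    have [ej|nj] := eqVneq j n.+1; last by apply: mono; lia.
    have [ei|ni] := eqVneq i n.+1; first by rewrite ei ej.
    by rewrite ej -ef; apply: mono; lia.
  have [->|ni] := eqVneq i n; first by rewrite -ef; lia.
  by apply: stp; lia.
have enf : e (f n) (f n.+1) by case: (st n (ltnSn n)) => // ef; rewrite ef eqxx in nf.
have fnotin : f n.+1 \notin p.
  apply/negP => /mp[i li ef]; case/eqP: nf; rewrite ef.
  by apply: cv (esym ef) => //; lia.
have idx i : i <= n -> index (f i) (rcons p (f n.+1)) = index (f i) p.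
  by move=> li; rewrite -cats1 index_cat (_ : f i \in p) //; apply/mp; exists i.
have idn : index (f n.+1) (rcons p (f n.+1)) = size p.
  by rewrite -cats1 index_cat (negPf fnotin) /= eqxx addn0.
have ltp i : i <= n -> index (f i) p < size p.
  by move=> li; rewrite index_mem; apply/mp; exists i.
exists (rcons p (f n.+1)); split.
- by rewrite -size_eq0 size_rcons.
- have ll : last (f n) p = f n.
    by have := nth_index (f n) fnp; rewrite lastp nth_last.
  case: p p0 sp ll {up mp mono stp fnp lastp fnotin idx idn ltp} => //= a p _.
  by rewrite rcons_path => -> ->.
- by rewrite rcons_uniq fnotin.
- move=> x; rewrite mem_rcons inE; split.
    by case/orP => [/eqP ->|/mp[i li ->]]; [exists n.+1 | exists i => //; lia].
  move=> [i li ->]; have [->|ni] := eqVneq i n.+1; first by rewrite eqxx.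
  by apply/orP; right; apply/mp; exists i => //; lia.
split=> [i j ij|i li].
  have [ej|nj] := eqVneq j n.+1; last by rewrite !idx; try lia; apply: mono; lia.
  have [ei|ni] := eqVneq i n.+1; first by rewrite ei ej.
  by rewrite ej idn idx; [apply/ltnW/ltp|]; lia.
have [->|ni] := eqVneq i n; last by rewrite !idx; try lia; apply: stp; lia.
by rewrite idn idx // lastp; lia.
Qed.

(* The order of x2 and x3, and that of y2 and y3, is free, and they may coincide.
   Contracting P and Q to three vertices each, with x1, {x2, x3}, x4 and
   y1, {y2, y3}, y4 apart, gives an XX linkage minor. *)
Definition crossing (G : sgraph) (P Q : seq G) :=
  exists x1 x2 x3 x4 y1 y2 y3 y4 : G,
  [/\ all (mem P) [:: x1; x2; x3; x4], all (mem Q) [:: y1; y2; y3; y4],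
      [&& index x1 P < index x2 P, index x1 P < index x3 P,
          index x2 P < index x4 P & index x3 P < index x4 P],
      [&& index y1 Q < index y2 Q, index y1 Q < index y3 Q,
          index y2 Q < index y4 Q & index y3 Q < index y4 Q]
    & [&& adj x1 y2, adj x4 y3, adj x2 y1 & adj x3 y4]].

(** * Crossings and XX linkage minors *)

Local Notation K24 := (complete_bipartite 2 4).

Lemma degree_Kmn m n (h : complete_bipartite m n) :
  degree h = if h is inl _ then n else m.
Proof.
rewrite /degree; case: h => i.
  rewrite -[RHS]card_ord -(card_imset _ (@inr_inj 'I_m 'I_n)).
  apply: eq_card => -[j|j]; rewrite inE /=; apply/esym; last exact: imset_f.
  by apply/imsetP => -[].
rewrite -[RHS]card_ord -(card_imset _ (@inl_inj 'I_m 'I_n)).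
apply: eq_card => -[j|j]; rewrite inE /=; apply/esym; first exact: imset_f.
by apply/imsetP => -[].
Qed.

Lemma K24_degree2 : [set h : K24 | degree h == 2] = [set inr j | j : 'I_4].
Proof.
apply/setP => -[i|j]; rewrite inE degree_Kmn; apply/esym; last exact: imset_f.
by apply/imsetP => -[].
Qed.

Section XX.
Variables (G : sgraph) (P Q : seq G).
Hypothesis lPQ : linkage [:: P; Q].
Hypothesis sPQ : spanning [:: P; Q].
Hypothesis nc : no_chord P Q.

Lemma ends2 : exists p0 pe q0 qe : G,
  [/\ path_ends P = [set p0; pe] /\ path_ends Q = [set q0; qe],
      p0 \in P /\ pe \in P, q0 \in Q /\ qe \in Q,
      forall x, x \in P -> pos P Q p0 <= pos P Q x <= pos P Q pe
    & forall x, x \in Q -> pos P Q q0 <= pos P Q x <= pos P Q qe].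
Proof.
have [P0 Q0 uP uQ] := linkage2 lPQ; have iQ := in_Q lPQ sPQ.
rewrite /pos; move: iQ.
case: (P) P0 uP => // p0 s _ uP; case: (Q) Q0 uQ => // q0 t _ uQ iQ.
exists p0, (last p0 s), q0, (last q0 t); split=> //.
- by rewrite mem_head mem_last.
- by rewrite mem_head mem_last.
- move=> x xP; rewrite mem_head mem_last xP index_last // index_head leq0n -ltnS.
  by rewrite -[(size s).+1]/(size (p0 :: s)) index_mem.
move=> x xQ; have := iQ q0; have := iQ (last q0 t); have := iQ x.
rewrite xQ mem_head mem_last => /esym/negPf -> /esym/negPf -> /esym/negPf ->.
rewrite index_last // index_head leq0n -ltnS.
by rewrite -[(size t).+1]/(size (q0 :: t)) index_mem.
Qed.

(** The end vertices of both paths go to the four degree-2 vertices, and each path also meets a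
    degree-4 vertex. The four edges joining the latter to the terminals of the opposite path lift to
    the rungs of a crossing. *)
Lemma XX_crossing : has_XX [:: P; Q] -> crossing P Q.
Proof.
move=> [phi [/(linkage_minorP lPQ sPQ _ nc)[surj fib cons adjE] phiT]].
have [p0 [pe [q0 [qe [[eP eQ] [p0P peP] [q0Q qeQ] bP bQ]]]]] := ends2.
have iQ := in_Q lPQ sPQ.
have Tim : phi @: ([set p0; pe] :|: [set q0; qe]) = [set inr j | j : 'I_4].
  by rewrite -K24_degree2 -phiT /terminals !big_cons big_nil setU0 eP eQ.
have inrT x : x \in [set p0; pe] :|: [set q0; qe] -> exists j, phi x = inr j.
  move=> xT; have : phi x \in [set inr j | j : 'I_4] by rewrite -Tim imset_f.
  by case/imsetP => j _ ->; exists j.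
have card4 : #|[set (inr j : K24) | j : 'I_4]| = 4.
  by rewrite card_imset ?card_ord // => ? ? [].
have uniq4 : uniq [seq phi x | x <- [:: p0; pe; q0; qe]].
  rewrite -[uniq _]negbK; apply/negP => nu.
  have := card4; rewrite -Tim.
  have -> : phi @: ([set p0; pe] :|: [set q0; qe]) =
     [set h in [seq phi x | x <- [:: p0; pe; q0; qe]]].
    by apply/setP => h; rewrite !imsetU !imset_set1 !inE /= -!orbA.
  rewrite cardsE => c4; case/negP: nu; apply/card_uniqP; exact: c4.
(* Degree-2 vertices are pairwise nonadjacent, so a path whose image avoids the degree-4 vertices
   would be mapped to a single vertex, starting from its first vertex [a]. *)
have hub a b : a \in [set p0; pe] :|: [set q0; qe] ->
    same_path P a b -> (forall x, same_path P a x -> pos P Q a <= pos P Q x) ->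
    phi a <> phi b -> exists w i, same_path P a w /\ phi w = inl i.
  move=> aT sab amin nab.
  have [/existsP[w /andP[saw]]|/existsPn no] :=
      boolP [exists w, same_path P a w && if phi w is inl _ then true else false].
    by case ew: (phi w) => [i|//] _; exists w, i.
  case: nab; move: {2}(pos P Q b) (erefl (pos P Q b)) => k.
  elim: k b sab => [|k IH] b sab eb.
    by congr phi; apply: (pos_inj lPQ sPQ sab); have := amin b sab; lia.
  have lek : k <= pos P Q b by lia.
  have [z sbz pz] := pos_onto lPQ sPQ lek.
  have saz := same_pathT sab sbz.
  rewrite (IH z saz pz).
  have czb : consec P Q z b by rewrite /consec (same_pathC P) sbz pz eb eqxx.
  case: (cons _ _ czb) => // adjzb; exfalso.
  have := no z; have := no b; rewrite saz sab /=; move: adjzb.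
  by case: (phi z) (phi b) => [i|i] [j|j].
(* The fibre of the first vertex is an interval starting there, so it precedes every vertex outside
   it; [high] is the mirror image. *)
have low a w x : (forall x, same_path P a x -> pos P Q a <= pos P Q x) ->
    phi x = phi a -> same_path P a w -> phi w <> phi a -> pos P Q x < pos P Q w.
  move=> amin exa saw nwa; rewrite ltnNge; apply/negP => lwx; case: nwa.
  have [sax cax] := fib a x w (esym exa); apply: cax => //.
  by rewrite amin.
have high b w x : (forall x, same_path P b x -> pos P Q x <= pos P Q b) ->
    phi x = phi b -> same_path P b w -> phi w <> phi b -> pos P Q w < pos P Q x.
  move=> bmax exb sbw nwb; rewrite ltnNge; apply/negP => lxw; case: nwb.
  have [sxb cxb] := fib x b w exb; rewrite -exb; apply: cxb.
    exact: same_pathT sbw.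
  by rewrite lxw bmax.
have sP x y : x \in P -> same_path P x y -> y \in P by rewrite /same_path => -> /eqP <-.
have sQ x y : x \in Q -> same_path P x y -> y \in Q.
  by rewrite !iQ /same_path => /negPf -> /eqP <-.
have s'P x y : x \in P -> y \in P -> same_path P x y by rewrite /same_path => -> ->.
have s'Q x y : x \in Q -> y \in Q -> same_path P x y.
  by rewrite !iQ /same_path => /negPf -> /negPf ->.
have p0min x : same_path P p0 x -> pos P Q p0 <= pos P Q x.
  by move=> /(sP _ _ p0P)/bP/andP[].
have q0min x : same_path P q0 x -> pos P Q q0 <= pos P Q x.
  by move=> /(sQ _ _ q0Q)/bQ/andP[].
have pemax x : same_path P pe x -> pos P Q x <= pos P Q pe.
  by move=> /(sP _ _ peP)/bP/andP[].
have qemax x : same_path P qe x -> pos P Q x <= pos P Q qe.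
  by move=> /(sQ _ _ qeQ)/bQ/andP[].
have [j0 ep0] := inrT p0 ltac:(by rewrite !inE eqxx ?orbT).
have [j1 epe] := inrT pe ltac:(by rewrite !inE eqxx ?orbT).
have [j2 eq0] := inrT q0 ltac:(by rewrite !inE eqxx ?orbT).
have [j3 eqe] := inrT qe ltac:(by rewrite !inE eqxx ?orbT).
have [w [i [sw ew]]] : exists w i, same_path P p0 w /\ phi w = inl i.
  apply: (hub p0 pe) => //; first by rewrite !inE eqxx.
    exact: s'P.
  by apply/eqP; move: uniq4; rewrite /= !inE !negb_or => /andP[/andP[]].
have [z [j [sz ez]]] : exists w i, same_path P q0 w /\ phi w = inl i.
  apply: (hub q0 qe) => //; first by rewrite !inE eqxx !orbT.
    exact: s'Q.
  by apply/eqP; move: uniq4; rewrite /= !inE !negb_or => /and4P[].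
have [x1 [y2 [ex1 ey2 a1]]] := adjE (phi p0) (phi z) ltac:(by rewrite ez ep0).
have [x4 [y3 [ex4 ey3 a4]]] := adjE (phi pe) (phi z) ltac:(by rewrite ez epe).
have [x2 [y1 [ex2 ey1 a2]]] := adjE (phi w) (phi q0) ltac:(by rewrite ew eq0).
have [x3 [y4 [ex3 ey4 a3]]] := adjE (phi w) (phi qe) ltac:(by rewrite ew eqe).
have wP := sP _ _ p0P sw. have zQ := sQ _ _ q0Q sz.
have fP a x : a \in P -> phi x = phi a -> x \in P.
  by move=> aP exa; apply: (sP a) => //; apply: (fib a x a (esym exa)).1.
have fQ a x : a \in Q -> phi x = phi a -> x \in Q.
  by move=> aQ exa; apply: (sQ a) => //; apply: (fib a x a (esym exa)).1.
have x1P := fP _ _ p0P ex1. have x4P := fP _ _ peP ex4.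
have x2P := fP _ _ wP ex2. have x3P := fP _ _ wP ex3.
have y1Q := fQ _ _ q0Q ey1. have y4Q := fQ _ _ qeQ ey4.
have y2Q := fQ _ _ zQ ey2. have y3Q := fQ _ _ zQ ey3.
have posP x : x \in P -> index x P = pos P Q x by rewrite /pos => ->.
have posQ x : x \in Q -> index x Q = pos P Q x by rewrite iQ /pos => /negPf ->.
exists x1, x2, x3, x4, y1, y2, y3, y4; split=> /=.
- by rewrite x1P x2P x3P x4P.
- by rewrite y1Q y2Q y3Q y4Q.
- rewrite !posP //; apply/and4P.
  split; [apply: (low p0) | apply: (low p0) | apply: (high pe) | apply: (high pe)];
    rewrite ?ex1 ?ex2 ?ex3 ?ex4 ?ew ?ep0 ?epe //; exact: s'P.
- rewrite !posQ //; apply/and4P.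
  split; [apply: (low q0) | apply: (low q0) | apply: (high qe) | apply: (high qe)];
    rewrite ?ey1 ?ey2 ?ey3 ?ey4 ?ez ?eq0 ?eqe //; exact: s'Q.
- by rewrite a1 a4 a2 a3.
Qed.

(** Cut [P] into the part up to [x1], the part strictly between [x1] and [x4], and the part from
    [x4]; cut [Q] likewise at [y1] and [y4]. Middle parts go to degree-4 vertices, outer parts to
    degree-2 vertices. *)
Lemma crossing_XX : crossing P Q -> has_XX [:: P; Q].
Proof.
move=> [x1 [x2 [x3 [x4 [y1 [y2 [y3 [y4 []]]]]]]]] /=.
have iQ := in_Q lPQ sPQ; rewrite !iQ.
have posP x : x \in P -> index x P = pos P Q x by rewrite /pos => ->.
have posQ x : x \notin P -> index x Q = pos P Q x by rewrite /pos => /negPf ->.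
case/and5P=> x1P x2P x3P x4P _; case/and5P=> y1Q y2Q y3Q y4Q _.
rewrite !posP // !posQ // => /and4P[x12 x13 x24 x34] /and4P[y12 y13 y24 y34].
case/and4P=> a1 a4 a2 a3.
(* Ordinals are known only through their values from here on, which keeps the case analysis free of
   bound proofs. *)
have [o2 o2v] : exists o : nat -> 'I_2, forall k, k < 2 -> o k = k :> nat.
  by exists inord; apply: inordK.
have [o4 o4v] : exists o : nat -> 'I_4, forall k, k < 4 -> o k = k :> nat.
  by exists inord; apply: inordK.
have [phi phiE] : exists phi : G -> K24, forall x, phi x =
  if x \in P then
    if pos P Q x <= pos P Q x1 then inr (o4 0) else
    if pos P Q x4 <= pos P Q x then inr (o4 1) else inl (o2 0)
  else
    if pos P Q x <= pos P Q y1 then inr (o4 2) else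
    if pos P Q y4 <= pos P Q x then inr (o4 3) else inl (o2 1).
  by eexists.
have phi1 x : x \in P -> pos P Q x <= pos P Q x1 -> phi x = inr (o4 0).
  by rewrite phiE => -> ->.
have phi4 x : x \in P -> pos P Q x4 <= pos P Q x -> phi x = inr (o4 1).
  rewrite phiE => -> l; case: ifP => [h|_].
    by exfalso; clear -h l x12 x24 y12 y24; lia.
  by rewrite l.
have phi2 x : x \in P -> pos P Q x1 < pos P Q x < pos P Q x4 -> phi x = inl (o2 0).
  by rewrite phiE => -> l; do 2 (case: ifP => [h|_]; first by exfalso; clear -h l; lia).
have psi1 x : x \notin P -> pos P Q x <= pos P Q y1 -> phi x = inr (o4 2).
  by rewrite phiE => /negPf -> ->.
have psi4 x : x \notin P -> pos P Q y4 <= pos P Q x -> phi x = inr (o4 3).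
  rewrite phiE => /negPf -> l; case: ifP => [h|_].
    by exfalso; clear -h l x12 x24 y12 y24; lia.
  by rewrite l.
have psi2 x : x \notin P -> pos P Q y1 < pos P Q x < pos P Q y4 -> phi x = inl (o2 1).
  by rewrite phiE => /negPf -> l; do 2 (case: ifP => [h|_]; first by exfalso; clear -h l; lia).
have o2P i : i = o2 0 \/ i = o2 1.
  by case: i => [[|[|]]] // lt; [left|right]; apply: val_inj; rewrite /= o2v.
have o4P i : [\/ i = o4 0, i = o4 1, i = o4 2 | i = o4 3].
  by case: i => [[|[|[|[|]]]]] // lt; [apply: Or41|apply: Or42|apply: Or43|apply: Or44];
   apply: val_inj; rewrite /= o4v.
have inr_o4 j k : inr (o4 j) = inr (o4 k) :> K24 -> j < 4 -> k < 4 -> j = k.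
  by move=> [/(congr1 val)] + lj lk; rewrite /= !o4v.
have inl_o2 j k : inl (o2 j) = inl (o2 k) :> K24 -> j < 2 -> k < 2 -> j = k.
  by move=> [/(congr1 val)] + lj lk; rewrite /= !o2v.
exists phi; split; last first.
  have [p0 [pe [q0 [qe [[eP eQ] [p0P peP] [q0Q qeQ] bP bQ]]]]] := ends2.
  rewrite K24_degree2 /terminals !big_cons big_nil setU0 eP eQ !imsetU !imset_set1.
  rewrite (phi1 p0) ?(phi4 pe) ?(psi1 q0) ?(psi4 qe) -?iQ //;
   try by [case/andP: (bP _ x1P) | case/andP: (bP _ x4P) |
    case/andP: (bQ y1 ltac:(by rewrite iQ)) | case/andP: (bQ y4 ltac:(by rewrite iQ))].
  apply/setP => h; rewrite !inE; apply/idP/imsetP => [|[i _ ->]].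
    by case/orP=> /orP[] /eqP ->; eexists.
  by case: (o4P i) => ->; rewrite eqxx ?orbT.
apply/(linkage_minorP lPQ sPQ _ nc).
(* Of the eight edges of K_{2,4}, four are the rungs of the crossing. The other four are the path
   edges that follow [x1] and [y1] or precede [x4] and [y4]. *)
have adjE i j : exists x y, [/\ phi x = inl i, phi y = inr j & adj x y].
  have next x : x \in P -> pos P Q x < pos P Q x4 ->
      exists z, [/\ z \in P, pos P Q z = (pos P Q x).+1 & adj z x].
    move=> xP lt; have [z sz pz] := pos_onto lPQ sPQ lt.
    have zP : z \in P by move: sz; rewrite /same_path x4P => /eqP <-.
    exists z; split=> //; apply: (consec_adj lPQ sPQ).
    by rewrite /consec /same_path zP xP pz !eqxx orbT.
  have nextQ x : x \notin P -> pos P Q x < pos P Q y4 ->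
      exists z, [/\ z \notin P, pos P Q z = (pos P Q x).+1 & adj z x].
    move=> xP lt; have [z sz pz] := pos_onto lPQ sPQ lt.
    have zP : z \notin P by move: sz; rewrite /same_path (negPf y4Q) => /eqP <-.
    exists z; split=> //; apply: (consec_adj lPQ sPQ).
    by rewrite /consec /same_path (negPf zP) (negPf xP) pz !eqxx orbT.
  have prev : exists z, [/\ z \in P, (pos P Q z).+1 = pos P Q x4 & adj z x4].
    have lt : (pos P Q x4).-1 <= pos P Q x4 by exact: leq_pred.
    have [z sz pz] := pos_onto lPQ sPQ lt.
    have zP : z \in P by move: sz; rewrite /same_path x4P => /eqP <-.
    have pz' : (pos P Q z).+1 = pos P Q x4 by clear -pz x24; lia.
    exists z; split=> //; apply: (consec_adj lPQ sPQ).
    by rewrite /consec /same_path zP x4P pz' !eqxx.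
  have prevQ : exists z, [/\ z \notin P, (pos P Q z).+1 = pos P Q y4 & adj z y4].
    have lt : (pos P Q y4).-1 <= pos P Q y4 by exact: leq_pred.
    have [z sz pz] := pos_onto lPQ sPQ lt.
    have zP : z \notin P by move: sz; rewrite /same_path (negPf y4Q) => /eqP <-.
    have pz' : (pos P Q z).+1 = pos P Q y4 by clear -pz y24; lia.
    exists z; split=> //; apply: (consec_adj lPQ sPQ).
    by rewrite /consec /same_path (negPf zP) (negPf y4Q) pz' !eqxx.
  case: (o2P i) => ->; case: (o4P j) => ->.
  - have [||z [zP pz zx]] := next x1 => //; first by clear -x12 x24 y12 y24; lia.
    by exists z, x1; rewrite phi2 ?phi1 //; clear -pz x12 x13 x24 x34 y12 y13 y24 y34; lia.
  - have [z [zP pz zx]] := prev.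
    by exists z, x4; rewrite phi2 ?phi4 //; clear -pz x12 x13 x24 x34 y12 y13 y24 y34; lia.
  - by exists x2, y1; rewrite phi2 ?psi1 //;
    clear -x12 x13 x24 x34 y12 y13 y24 y34; lia.
  - by exists x3, y4; rewrite phi2 ?psi4 //;
    clear -x12 x13 x24 x34 y12 y13 y24 y34; lia.
  - by exists y2, x1; rewrite psi2 ?phi1 1?adj_sym //;
    clear -x12 x13 x24 x34 y12 y13 y24 y34; lia.
  - by exists y3, x4; rewrite psi2 ?phi4 1?adj_sym //;
    clear -x12 x13 x24 x34 y12 y13 y24 y34; lia.
  - have [||z [zP pz zx]] := nextQ y1 => //; first by clear -x12 x24 y12 y24; lia.
    by exists z, y1; rewrite psi2 ?psi1 //; clear -pz x12 x13 x24 x34 y12 y13 y24 y34; lia.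
  - have [z [zP pz zx]] := prevQ.
    by exists z, y4; rewrite psi2 ?psi4 //; clear -pz x12 x13 x24 x34 y12 y13 y24 y34; lia.
split.
- case=> i; first by have [x [y [ex _ _]]] := adjE i ord0; exists x.
  by have [x [y [_ ey _]]] := adjE ord0 i; exists y.
- clear -phiE inr_o4 inl_o2 x12 x13 x24 x34 y12 y13 y24 y34.
  move=> x y z; rewrite !phiE /same_path.
  case: (x \in P); case: (y \in P); case: (z \in P); repeat (case: ifP => ?); move=> // E;
    try (by have := inr_o4 _ _ E isT isT); try (by have := inl_o2 _ _ E isT isT);
    split=> // _ ?; exfalso; lia.
- clear -phiE x12 x13 x24 x34 y12 y13 y24 y34.
  move=> x y /andP[]; rewrite !phiE /same_path.
  by case: (x \in P); case: (y \in P) => // _; repeat (case: ifP => ?); move=> ?;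
    (by auto) || (exfalso; lia).
- case=> [i|i] [j|j] //= _.
  by have [x [y [ex ey xy]]] := adjE j i; exists y, x; rewrite adj_sym.
Qed.

End XX.

(** * Vital linkages have neither chords nor crossings *)

Lemma sorted_cat_cons (T : Type) (e : rel T) s x t :
  sorted e (s ++ x :: t) = sorted e (rcons s x) && path e x t.
Proof. by case: s => [|y s] //=; rewrite -cat_rcons cat_path last_rcons. Qed.

Lemma path_ends_cat (G : sgraph) (s : seq G) x t :
  path_ends (s ++ x :: t) = [set head x s; last x t].
Proof. by case: s => [|y s] //=; rewrite last_cat. Qed.

Lemma split_index (T : eqType) (p : seq T) x : x \in p ->
  p = take (index x p) p ++ x :: drop (index x p).+1 p.
Proof.
move=> xp; rewrite -{1}(cat_take_drop (index x p) p) (drop_nth x) ?index_mem //.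
by rewrite nth_index.
Qed.

Lemma split2 (T : eqType) (p : seq T) x y :
  x \in p -> y \in p -> index x p < index y p ->
  exists s m t, p = s ++ x :: m ++ y :: t /\
    forall z, z \in p -> index x p < index z p < index y p -> z \in m.
Proof.
move=> xp yp lt; have ey := split_index yp; set q := take _ p in ey.
have inq z : z \in p -> (z \in q) = (index z p < index y p) by exact: in_take.
have idq z : z \in q -> index z q = index z p by rewrite ey index_cat => ->.
have xq : x \in q by rewrite inq.
exists (take (index x q) q), (drop (index x q).+1 q), (drop (index y p).+1 p).
split=> [|z zp /andP[xz zy]]; first by rewrite -cat_cons catA -(split_index xq).
have zq : z \in q by rewrite inq.
rewrite -(idq _ xq) -(idq _ zq) in xz.
have := zq; rewrite {1}(split_index xq) mem_cat inE in_take // ltnNge (ltnW xz) /=.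
by case: eqP xz => [->|//]; rewrite ltnn.
Qed.

Lemma uniq_replace (T : eqType) (s m m' t : seq T) :
  uniq (s ++ m ++ t) -> uniq m' -> {subset m' <= m} -> uniq (s ++ m' ++ t).
Proof.
rewrite uniq_catCA (uniq_catCA s) !(@cat_uniq _ _ (s ++ t)).
case/and3P=> _ /hasPn H -> -> sub; rewrite andbT /=.
by apply/hasPn => x /H; apply: contra; apply: sub.
Qed.

(** The order of [x] and [y] in [m] is free, as it is for the inner vertices of a crossing; when [y]
    comes first, the reversed list is used. *)
Lemma segment (T : eqType) (e : rel T) (m : seq T) x y :
  symmetric e -> sorted e m -> uniq m -> x \in m -> y \in m ->
  exists s, [/\ path e x s, last x s = y, uniq (x :: s) & {subset x :: s <= m}].
Proof.
move=> esym.
have fwd u v : sorted e (u ++ x :: v) -> uniq (u ++ x :: v) -> y \in x :: v ->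
    exists s, [/\ path e x s, last x s = y, uniq (x :: s) & {subset x :: s <= u ++ x :: v}].
  rewrite sorted_cat_cons cat_uniq => /andP[_ pv] /and3P[_ _ uv] yv.
  case/splitPl: yv pv uv => v1 v2 lv; rewrite cat_path -cat_cons cat_uniq.
  move=> /andP[pv _] /andP[uv _]; exists v1; split=> // z zv.
  by rewrite !mem_cat zv /= !orbT.
move=> sm um xm ym; case/splitPr: xm sm um ym => u v sm um.
rewrite mem_cat => /orP[yu|]; last exact: fwd.
have E : rev (u ++ x :: v) = rev v ++ x :: rev u.
  by rewrite rev_cat rev_cons cat_rcons.
have [||| s [ps ls us sub]] := fwd (rev v) (rev u).
- by rewrite -E rev_sorted (eq_sorted (e' := e)) // => a b /=; rewrite esym.
- by rewrite -E rev_uniq.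
- by rewrite inE mem_rev yu orbT.
exists s; split=> // z /sub; by rewrite -E mem_rev.
Qed.

Lemma unique_swap (G : sgraph) (P Q : seq G) :
  unique_linkage [:: P; Q] -> unique_linkage [:: Q; P].
Proof.
move=> u L' l; rewrite lverts_swap ledges_swap => pe; apply: u => //.
by apply: perm_trans pe _; rewrite /= (perm_catC [:: _] [:: _]).
Qed.

(** An edge to a vertex further ahead on [P] would shortcut the path: same ends, but the vertices in
    between are no longer covered. *)
Lemma unique_induced (G : sgraph) (P Q : seq G) (x y : G) :
  linkage [:: P; Q] -> unique_linkage [:: P; Q] ->
  x \in P -> y \in P -> adj x y -> index y P <= (index x P).+1.
Proof.
move=> l u xP yP xy; rewrite leqNgt; apply/negP => lt.
have [s [m [t [eP _]]]] := split2 xP yP (ltnW lt).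
have := l; rewrite /linkage /= !cats0 => /andP[/and3P[/andP[_ sP] sQ _] uPQ].
have sP' : sorted (@adj G) (s ++ x :: y :: t).
  move: sP; rewrite eP !sorted_cat_cons /= cat_path /= xy.
  by case/and4P => -> _ _ ->.
have uP' : uniq ((s ++ x :: y :: t) ++ Q).
  have := uPQ; rewrite eP -!catA /= -!catA -cat_rcons => H.
  by have := uniq_replace H (isT : uniq [::]); rewrite cat_rcons; apply.
have [||/setP lv _] := u [:: s ++ x :: y :: t; Q].
- rewrite /linkage /= !cats0 sP' uP' sQ !andbT.
  by rewrite -size_eq0 size_cat /= addnS.
- by rewrite /= eP !path_ends_cat /= last_cat.
case: m eP => [|z m] eP.
  move: lt uPQ; rewrite eP cat_uniq => lt /andP[+ _]; rewrite cat_uniq /= !negb_or.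
  move=> /and4P[_ /and3P[xs ys _] + _]; rewrite ?inE ?negb_or => /andP[xy' _].
  by move: lt; rewrite !index_cat (negPf xs) (negPf ys) /= !eqxx (negPf xy') /=; clear; lia.
have zP : z \in P by rewrite eP !(mem_cat, inE) eqxx !orbT.
have : z \in lverts [:: P; Q] by rewrite in_set /= mem_cat zP.
rewrite -lv in_set /= cats0 => zin.
have : uniq (z :: m ++ (s ++ x :: y :: t) ++ Q).
  (* With the skipped [z :: m] added back, the shortened linkage is a permutation of [P ++ Q]; hence
     [z] cannot lie on it. *)
  rewrite -(perm_uniq (s1 := P ++ Q)) // eP; apply/permP => p.
  by rewrite /= ?count_cat /= ?count_cat /= ?count_cat /=; clear; lia.
by rewrite /= mem_cat zin orbT.
Qed.

Lemma vital_no_chord (G : sgraph) (P Q : seq G) :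
  linkage [:: P; Q] -> spanning [:: P; Q] -> unique_linkage [:: P; Q] ->
  no_chord P Q.
Proof.
move=> l s u x y xy sxy; have yx : adj y x by rewrite adj_sym.
have nxy : x != y by apply/eqP => E; rewrite E adj_irr in xy.
have nposE : pos P Q x != pos P Q y by apply: contra nxy => /eqP/(pos_inj l s sxy) ->.
rewrite /consec sxy /=.
suff : pos P Q x <= (pos P Q y).+1 /\ pos P Q y <= (pos P Q x).+1 by move: nposE; clear; lia.
move: sxy; rewrite /same_path /pos; have [xP|xP] := boolP (x \in P) => /eqP yP; rewrite -yP.
  by split; apply: (unique_induced l u).
have l' : linkage [:: Q; P] by rewrite linkage_swap.
by split; apply: (unique_induced l' (unique_swap u)); rewrite ?(in_Q l s) -?yP.
Qed.

Lemma vital_no_crossing (G : sgraph) (P Q : seq G) :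
  linkage [:: P; Q] -> spanning [:: P; Q] -> unique_linkage [:: P; Q] ->
  ~ crossing P Q.
Proof.
move=> l s u [x1 [x2 [x3 [x4 [y1 [y2 [y3 [y4 []]]]]]]]] /=.
case/and5P=> x1P x2P x3P x4P _ /and5P[y1Q y2Q y3Q y4Q _].
case/and4P=> x12 x13 x24 x34 /and4P[y12 y13 y24 y34] /and4P[a1 a4 a2 a3].
have y2P : y2 \notin P by rewrite -(in_Q l s).
have [s1 [m1 [t1 [eP midP]]]] := split2 x1P x4P (ltn_trans x12 x24).
have [s2 [m2 [t2 [eQ midQ]]]] := split2 y1Q y4Q (ltn_trans y12 y24).
have := l; rewrite /linkage /= !cats0 andbT => /andP[/andP[/andP[_ sP] /andP[_ sQ]] uPQ].
have y2m := midQ _ y2Q ltac:(by rewrite y12).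
have y3m := midQ _ y3Q ltac:(by rewrite y13).
have x2m := midP _ x2P ltac:(by rewrite x12).
have x3m := midP _ x3P ltac:(by rewrite x13).
move: sP sQ uPQ; rewrite eP eQ !sorted_cat_cons !cat_path /=.
move=> /and4P[sP1 pm1 _ pt1] /and4P[sQ1 pm2 _ pt2] uPQ.
have [_ _ uP uQ] := linkage2 l.
have um1 : uniq m1.
  by move: uP; rewrite eP cat_uniq /= cat_uniq => /and4P[_ _ _ /andP[]].
have um2 : uniq m2.
  by move: uQ; rewrite eQ cat_uniq /= cat_uniq => /and4P[_ _ _ /andP[]].
have asym := @adj_sym G.
have [t [pt lt ut tm]] := segment asym (path_sorted pm2) um2 y2m y3m.
have [t' [pt' lt' ut' tm']] := segment asym (path_sorted pm1) um1 x2m x3m.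
(* Exchange the middle parts: [y2 :: t] runs from [y2] to [y3] inside [Q], and [x2 :: t'] from [x2]
   to [x3] inside [P]. *)
have [||_ le] := u
  [:: s1 ++ x1 :: (y2 :: t) ++ x4 :: t1; s2 ++ y1 :: (x2 :: t') ++ y4 :: t2].
- rewrite /linkage /= !cats0 !andbT -!size_eq0 !size_cat /= !addnS /=.
  rewrite !sorted_cat_cons /= !cat_path /= pt lt pt' lt' pt1 pt2 sP1 sQ1.
  rewrite a1 a3 (adj_sym y3) a4 (adj_sym y1) a2 /=.
  (* In the list of all vertices, replace [m1] by [x2 :: t'] and then [m2] by [y2 :: t]; the
     rerouted linkage is a permutation of the result. *)
  have H : uniq (rcons s1 x1 ++ m1 ++ ((x4 :: t1) ++ rcons s2 y1 ++ m2 ++ y4 :: t2)).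
    by move: uPQ; rewrite !cat_rcons -!catA /= -!catA.
  have := uniq_replace H ut' tm'; rewrite !catA -[in X in X -> _]catA => H'.
  have := uniq_replace H' ut tm; apply: etrans; apply: perm_uniq.
  by apply/permP => p; rewrite -!cats1 ?count_cat /= ?count_cat /= ?count_cat /=; clear; lia.
- by rewrite [map _ _]/= [map _ [:: P; Q]]/= eP eQ !path_ends_cat /=
    ?(last_cat, last_cons) /= ?(last_cat, last_cons).
(* The new linkage uses the edge from [x1] to [y2], whose ends lie on different original paths. *)
have : [set x1; y2] \in ledges [:: P; Q].
  rewrite -le; apply/ledgeP; exists x1, y2; split=> //; left.
  by apply/mem_zip_beheadP; exists s1, (t ++ x4 :: t1).
by rewrite (mem_ledges l s) /consec /same_path x1P (negPf y2P).
Qed.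

(** * Without chords and crossings the linkage is unique *)

(** A discrete intermediate value theorem: the first step that takes [f] above [i] goes from [i] to
    [i.+1]. *)
Lemma cross_step (T : eqType) (f : T -> nat) x s i :
  path (fun u v => f v <= (f u).+1) x s -> f x <= i < f (last x s) ->
  exists u v, [/\ (u, v) \in zip (x :: s) s, f u = i & f v = i.+1].
Proof.
elim: s x => [|y s IH] x /=; first by lia.
move=> /andP[xy pp] /andP[xi il]; have [yi|iy] := leqP (f y) i.
  have [|u [v [uv fu fv]]] := IH _ pp; first by rewrite yi.
  by exists u, v; rewrite inE uv orbT.
by exists x, y; rewrite inE eqxx; split=> //; lia.
Qed.

(** Here [y] is the last vertex before the walk first leaves [A]. Up to there [f] rises by at most
    one per step, so no value between [f x] and [f y] is skipped. *)
Lemma first_exit (T : eqType) (e : rel T) (A : pred T) (f : T -> nat) x s :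
  (forall u v, A u -> A v -> e u v -> f v <= (f u).+1) ->
  A x -> path e x s -> ~~ all A (x :: s) ->
  exists y z, [/\ A y, ~~ A z, z \in x :: s, e y z &
    forall i, f x <= i <= f y -> exists2 w, w \in x :: s & A w /\ f w = i].
Proof.
move=> st; elim: s x => [|y s IH] x Ax /=; first by rewrite Ax.
move=> /andP[xy pp]; rewrite Ax /= => nall.
have [Ay|nAy] := boolP (A y); last first.
  exists x, y; split=> //; first by rewrite !inE eqxx orbT.
  by move=> i ii; exists x; [rewrite inE eqxx | split=> //; lia].
have [a [b [Aa nAb bs ab cov]]] := IH y Ay pp nall.
exists a, b; split=> //; first by rewrite inE bs orbT.
move=> i ii; have [<-|ni] := eqVneq (f x) i; first by exists x; rewrite ?inE ?eqxx.
have [|w ws [Aw fw]] := cov i; first by have := st x y Ax Ay xy; lia.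
by exists w; rewrite // inE ws orbT.
Qed.

Section Walk.
Variables (T : eqType) (e : rel T) (p0 : T) (s s' : seq T).
Notation P := (p0 :: s).
Notation P' := (p0 :: s').
Hypothesis esym : symmetric e.
Hypothesis uP : uniq P.
Hypothesis ind : forall x y, x \in P -> y \in P -> e x y ->
  index y P <= (index x P).+1.
Hypothesis sP' : path e p0 s'.
Hypothesis lst : last p0 s' = last p0 s.

(** Take the first departure from [P], seen from either end of [P']. Before it, [P'] covers all of
    [P] from that end up to the departure vertex, so vertices of [P] missed by [P'] lie strictly
    between [x1] and [x4]. *)
Lemma walk_detour : ~~ all (mem P) P' ->
  exists x1 y2 y3 x4, [/\ x1 \in P /\ x4 \in P, y2 \notin P /\ y3 \notin P,
    y2 \in P' /\ y3 \in P', e x1 y2 /\ e y3 x4 &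
    forall z, z \in P -> z \notin P' -> index x1 P < index z P < index x4 P].
Proof.
move=> nall; have p0P : p0 \in P by exact: mem_head.
have [x1 [y2 [x1P y2P y2P' xy cov]]] :=
  @first_exit T e (mem P) (fun z => index z P) p0 s' ind p0P sP' nall.
(* Position counted from the far end of [P], for the walk read backwards; by [idl] the subtraction
   does not truncate on [P]. *)
pose f z := (size s - index z P)%N.
have idl z : z \in P -> index z P <= size s by rewrite -index_mem.
have rP' : rev P' = last p0 s :: rev (belast p0 s') by rewrite lastI rev_rcons lst.
have lP : last p0 s \in P by exact: mem_last.
have [||| x4 [y3 [x4P y3P y3P' yx cov']]] :=
  @first_exit T e (mem P) f (last p0 s) (rev (belast p0 s')) _ lP.
- move=> u v uP' vP' uv; have := ind vP' uP' ltac:(by rewrite esym).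
  by have := idl u uP'; rewrite /f; clear; lia.
- by rewrite -lst rev_path (eq_path (e' := e)) // => a b /=; rewrite esym.
- by rewrite -rP' all_rev.
rewrite -rP' mem_rev in y3P'.
exists x1, y2, y3, x4; split=> // [|z zP zP']; first by rewrite (esym y3).
apply/andP; split; rewrite ltnNge; apply/negP => le.
  have [|w wP' [wP wz]] := cov (index z P).
    by rewrite index_head.
  by move: zP'; rewrite -(index_inj p0 wP zP wz) wP'.
have [|w wP' [wP wz]] := cov' (f z).
  by rewrite /f index_last //; have := idl z zP; move: le; clear; lia.
have := idl z zP; have := idl w wP; rewrite /f in wz => h1 h2.
have ewz : index w P = index z P by move: wz h1 h2; clear; lia.
by move: zP'; rewrite -(index_inj p0 wP zP ewz) -mem_rev rP' wP'.
Qed.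

(** Inside [P] the walk advances by at most one position per step and runs from the first to the
    last, so it takes every step of [P] in the forward direction. *)
Lemma walk_stay : all (mem P) P' ->
  {subset zip P s <= zip P' s'} /\ {subset P <= P'}.
Proof.
move=> al; have pf : path (fun u v => index v P <= (index u P).+1) p0 s'.
  by apply: sub_in_path al sP' => u v uP' vP'; apply: ind.
have sub : {subset zip P s <= zip P' s'}.
  move=> [u v]; rewrite (mem_zip_behead (p := P)) // => /and3P[uP' vP' /eqP uv].
  have [|a [b [ab fa fb]]] := @cross_step T (fun z => index z P) p0 s' (index u P) pf.
    by rewrite lst index_last // index_head uv leq0n -ltnS -[(size s).+1]/(size P) index_mem.
  have /mem_zip_beheadP[l1 [l2 eP']] : (a, b) \in zip P' (behead P') by [].
  have inP z : z \in P' -> z \in P by move/(allP al).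
  have aP : a \in P by apply: inP; rewrite eP' !(mem_cat, inE) eqxx ?orbT.
  have bP : b \in P by apply: inP; rewrite eP' !(mem_cat, inE) eqxx ?orbT.
  rewrite uv in fb.
  by rewrite -(index_inj p0 aP uP' fa) -(index_inj p0 bP vP' fb).
split=> // z; rewrite lastI mem_rcons inE => /orP[/eqP ->|]; first by rewrite -lst mem_last.
move=> zb; have : (z, nth z P (index z P).+1) \in zip P s.
  have szb : index z P < size s.
    by rewrite lastI -cats1 index_cat zb -(size_belast p0) index_mem.
  rewrite (mem_zip_behead (p := P)) // index_uniq // eqxx andbT.
  by rewrite lastI mem_rcons inE zb orbT -lastI mem_nth.
move/sub; have zz := @mem_zip_beheadP _ P' => /(zz _ _)[l1 [l2 ->]].
by rewrite mem_cat inE eqxx orbT.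
Qed.

End Walk.

Lemma perm_eq2 (T : eqType) (a b c d : T) :
  perm_eq [:: a; b] [:: c; d] -> (a = c /\ b = d) \/ (a = d /\ b = c).
Proof.
move=> pe; have := perm_mem pe a; rewrite !inE eqxx /= => /esym/orP[] /eqP E; subst.
  by left; move: pe; rewrite perm_cons => /perm_small_eq -/(_ isT) [->].
right; move: pe; rewrite perm_sym (perm_catC [:: c] [:: d]) perm_cons.
by move/perm_small_eq => /(_ isT) [->].
Qed.

(** Since [path_ends] forgets the direction, one of [p] and its reversal starts at [p0]. *)
Lemma orient (G : sgraph) (p0 : G) s p : p != [::] ->
  path_ends p = path_ends (p0 :: s) ->
  exists s', (p = p0 :: s' \/ rev p = p0 :: s') /\ last p0 s' = last p0 s.
Proof.
case: p => // x t _ /eq_set2[] [ex el].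
  by rewrite -ex in el *; exists t; split; [left|].
exists (rev (belast x t)); split; last first.
  by rewrite -ex; case: (t) el => [|y u] /= el; rewrite ?rev_cons ?last_rcons.
by right; rewrite lastI rev_rcons el.
Qed.

Section Unique.
Variables (G : sgraph) (p0 q0 : G) (s t : seq G).
Notation P := (p0 :: s).
Notation Q := (q0 :: t).
Hypothesis lPQ : linkage [:: P; Q].
Hypothesis sPQ : spanning [:: P; Q].
Hypothesis nc : no_chord P Q.
Hypothesis nX : ~ crossing P Q.

Lemma unique_oriented s' t' : linkage [:: p0 :: s'; q0 :: t'] ->
  last p0 s' = last p0 s -> last q0 t' = last q0 t ->
  ledges [:: p0 :: s'; q0 :: t'] = ledges [:: P; Q] /\
  lverts [:: p0 :: s'; q0 :: t'] = lverts [:: P; Q].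
Proof.
move=> l' lp lq; have [_ _ uP uQ] := linkage2 lPQ.
have inQ := in_Q lPQ sPQ.
have /andP[/and3P[/andP[_ sp] /andP[_ sq] _]] := l'.
rewrite -[flatten _]/((p0 :: s') ++ (q0 :: t') ++ [::]) cats0 cat_uniq.
move=> /and3P[_ /hasPn dis _].
have indP x y : x \in P -> y \in P -> adj x y -> index y P <= (index x P).+1.
  move=> xP yP /nc; rewrite /consec /same_path xP yP eqxx => /(_ isT)/andP[_].
  by rewrite /pos xP yP => /orP[] /eqP; clear; lia.
have indQ x y : x \in Q -> y \in Q -> adj x y -> index y Q <= (index x Q).+1.
  rewrite !inQ => xP yP /nc; rewrite /consec /same_path /pos (negPf xP) (negPf yP) eqxx.
  by move=> /(_ isT)/andP[_]/orP[] /eqP; clear; lia.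
have asym := @adj_sym G.
have disj z : z \in p0 :: s' -> z \in q0 :: t' -> False.
  by move=> zp /dis/negP; apply.
have stayP := walk_stay uP indP sp lp; have stayQ := walk_stay uQ indQ sq lq.
have detP := walk_detour asym uP indP sp lp; have detQ := walk_detour asym uQ indQ sq lq.
(* If [P'] leaves [P] it meets [Q], so [Q'] cannot cover [Q] and leaves it too. By disjointness, the
   detour vertices of each path are missed by the other, so they lie strictly between the latter's
   departure vertices: a crossing. *)
have [aP|nP] := boolP (all (mem P) (p0 :: s')); last first.
  have [x1 [y2 [y3 [x4 [[x1P x4P] [y2P y3P] [y2' y3'] [xy yx] bP]]]]] := detP nP.
  have [aQ|nQ] := boolP (all (mem Q) (q0 :: t')).
    by case: (disj y2 y2'); apply: (stayQ aQ).2; rewrite inQ.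
  have [y1 [x2 [x3 [y4 [[y1Q y4Q] [x2Q x3Q] [x2' x3'] [yx' xy'] bQ]]]]] := detQ nQ.
  rewrite !inQ !negbK in x2Q x3Q; rewrite -!inQ in y2P y3P.
  have ofP z : z \in q0 :: t' -> z \notin p0 :: s' by move=> zq; apply/negP => /disj.
  have ofQ z : z \in p0 :: s' -> z \notin q0 :: t' by move=> zp; apply/negP => /(disj _ zp).
  case: nX; exists x1, x2, x3, x4, y1, y2, y3, y4.
  have /andP[h1 h2] := bP _ x2Q (ofP _ x2'); have /andP[h3 h4] := bP _ x3Q (ofP _ x3').
  have /andP[h5 h6] := bQ _ y2P (ofQ _ y2'); have /andP[h7 h8] := bQ _ y3P (ofQ _ y3').
  split.
  - by apply/and5P.
  - by apply/and5P.
  - by rewrite h1 h2 h3 h4.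
  - by rewrite h5 h6 h7 h8.
  - by rewrite xy (adj_sym x4) yx (adj_sym x2) yx' xy'.
have aQ : all (mem Q) (q0 :: t').
  apply/negP => /negP/detQ[y1 [x2 [x3 [y4 [_ [x2Q _] [x2' _] _ _]]]]].
  by apply: (disj x2) => //; apply: (stayP aP).2; rewrite inQ negbK in x2Q.
split.
  (* Both walks stay on their paths: their edges are path edges because there are no chords, and
     every path edge is used by [walk_stay]. *)
  apply/eqP; rewrite eqEsubset; apply/andP; split; apply/subsetP => e.
    move=> /ledgeP[x [y [-> xy]]]; rewrite (mem_ledges lPQ sPQ).
    case: xy => xy; apply: nc.
    - by apply: (sorted_zip _ _).1 xy.
    - move/mem_zip_beheadP: xy => [l1 [l2 e']].
      have xP : x \in P by apply: (allP aP); rewrite e' mem_cat inE eqxx orbT.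
      have yP : y \in P by apply: (allP aP); rewrite e' mem_cat !inE eqxx !orbT.
      by rewrite /same_path xP yP.
    - by apply: (sorted_zip _ _).1 xy.
    - move/mem_zip_beheadP: xy => [l1 [l2 e']].
      have : x \in Q by apply: (allP aQ); rewrite e' mem_cat inE eqxx orbT.
      have : y \in Q by apply: (allP aQ); rewrite e' mem_cat !inE eqxx !orbT.
      by rewrite !inQ /same_path => /negPf -> /negPf ->.
  move=> /ledgeP[x [y [-> xy]]]; apply/ledgeP; exists x, y; split=> //.
  by case: xy => xy; [left; apply: (stayP aP).1 | right; apply: (stayQ aQ).1].
rewrite sPQ; apply/setP => z; rewrite in_set in_setT.
have : z \in lverts [:: P; Q] by rewrite sPQ in_setT.
rewrite in_set /= !cats0 -!cat_cons !mem_cat => /orP[] zz; apply/orP.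
  by left; apply: (stayP aP).2.
by right; apply: (stayQ aQ).2.
Qed.

Lemma unique_up_to_reversal p q : linkage [:: p; q] ->
  path_ends p = path_ends P -> path_ends q = path_ends Q ->
  ledges [:: p; q] = ledges [:: P; Q] /\
  lverts [:: p; q] = lverts [:: P; Q].
Proof.
move=> l ep eq; have [p_n q_n _ _] := linkage2 l.
have [s' [hp lp]] := orient p_n ep; have [t' [hq lq]] := orient q_n eq.
have lrev := linkage_rev l.
have lrev2 : linkage [:: p; rev q].
  by rewrite linkage_swap linkage_rev // linkage_swap.
have lrev3 : linkage [:: rev p; rev q] by exact: linkage_rev.
have eR (r : seq G) : ledges [:: r; rev q] = ledges [:: r; q].
  by rewrite ledges_swap ledges_rev ledges_swap.
have vR (r : seq G) : lverts [:: r; rev q] = lverts [:: r; q].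
  by rewrite lverts_swap lverts_rev lverts_swap.
case: hp => hp; case: hq => hq.
- by rewrite hp hq in l *; apply: unique_oriented.
- by rewrite -eR -vR; rewrite hp hq in lrev2 *; apply: unique_oriented.
- by rewrite -(ledges_rev p) -(lverts_rev p); rewrite hp hq in lrev *; apply: unique_oriented.
- rewrite -(ledges_rev p) -(lverts_rev p) -eR -vR; rewrite hp hq in lrev3 *.
  by apply: unique_oriented.
Qed.

Lemma no_crossing_unique : unique_linkage [:: P; Q].
Proof.
move=> L' l' pe; have := perm_size pe; rewrite !size_map.
case: L' l' pe => [|p [|q []]] // l' /= /perm_eq2[] [ep eq] _.
  by have [] := unique_up_to_reversal l' ep eq.
rewrite linkage_swap in l'; rewrite ledges_swap lverts_swap.
by have [] := unique_up_to_reversal l' eq ep.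
Qed.

End Unique.

(** * Linkage minors of [Udd n] have no crossing *)

Local Notation Uu n := ([seq inl i | i <- enum 'I_n] : seq (Udd n)).
Local Notation Uv n := ([seq inr i | i <- enum 'I_n] : seq (Udd n)).

Section UddFacts.
Variable n : nat.
Notation U := (Uu n).
Notation V := (Uv n).

Lemma mem_U (x : Udd n) : (x \in U) = if x is inl _ then true else false.
Proof.
apply/mapP/idP => [[i _ ->] //|]; case: x => // i _; exists i => //.
by rewrite mem_enum.
Qed.

Lemma mem_V (x : Udd n) : (x \in V) = if x is inr _ then true else false.
Proof.
apply/mapP/idP => [[i _ ->] //|]; case: x => // i _; exists i => //.
by rewrite mem_enum.
Qed.

Lemma Udd_pos (x : Udd n) : pos U V x = match x with inl i | inr i => i end.
Proof.
rewrite /pos mem_U; case: x => i; rewrite index_map ?index_enum_ord //.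
  by move=> ? ? [].
by move=> ? ? [].
Qed.

Lemma Udd_same_path (x y : Udd n) : same_path U x y =
  match x, y with inl _, inl _ | inr _, inr _ => true | _, _ => false end.
Proof. by rewrite /same_path !mem_U; case: x y => i [] j. Qed.

Lemma Udd_linkageP : 0 < n -> linkage (Udd_linkage n).
Proof.
move=> n0; have srt : sorted
    (fun i j : 'I_n => (i.+1 == j :> nat) || (j.+1 == i :> nat)) (enum 'I_n).
  have : sorted (fun i j => (i.+1 == j) || (j.+1 == i)) (map val (enum 'I_n)).
    rewrite val_enum_ord; case: (n) 0 => // k m /=.
    by elim: k m => //= k IH m; rewrite eqxx IH.
  by rewrite sorted_map.
have inlI : injective (inl : 'I_n -> Udd n) by move=> ? ? [].
have inrI : injective (inr : 'I_n -> Udd n) by move=> ? ? [].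
rewrite /linkage /= !cats0 !andbT cat_uniq (map_inj_uniq inlI) (map_inj_uniq inrI).
have U0 : U != [::] by apply/eqP => E; have := mem_U (inl (Ordinal n0)); rewrite E.
have V0 : V != [::] by apply/eqP => E; have := mem_V (inr (Ordinal n0)); rewrite E.
have sU : sorted (@adj (Udd n)) U by rewrite sorted_map; exact: srt.
have sV : sorted (@adj (Udd n)) V by rewrite sorted_map; exact: srt.
rewrite U0 V0 sU sV enum_uniq andbT /=.
rewrite andbT; by apply/hasPn => x; rewrite mem_V /= mem_U; case: x.
Qed.

Lemma Udd_spanning : spanning (Udd_linkage n).
Proof.
apply/setP => x; rewrite in_set in_setT /= cats0 mem_cat mem_U mem_V.
by case: x.
Qed.

Lemma Udd_no_chord : no_chord U V.
Proof.
by move=> x y; rewrite /consec !Udd_pos Udd_same_path; case: x y => i [] j.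
Qed.

End UddFacts.

Lemma Truemper_no_XX (G : sgraph) : Truemper G ->
  exists L : seq (seq G),
    [/\ linkage L, size L = 2, spanning L, chordless L & ~ has_XX L].
Proof.
move=> [[|m] [] // n0 [phi]].
move=> /(linkage_minorP (Udd_linkageP n0) (@Udd_spanning m.+1) _ (@Udd_no_chord m.+1)).
move=> [surj fib cons adjE].
(* The component [c] of [Udd n] has a path as its image, along which the index is monotone in the
   level and grows by at most one per level. *)
have seg (c : 'I_m.+1 -> Udd m.+1) :
    (forall i j : 'I_m.+1, same_path (Uu m.+1) (c i) (c j)) ->
    (forall i : 'I_m.+1, pos (Uu m.+1) (Uv m.+1) (c i) = i) ->
  exists p : seq G, [/\ p != [::], sorted (@adj G) p, uniq p,
    forall x, x \in p <-> exists i : 'I_m.+1, x = phi (c i) &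
    (forall i j : 'I_m.+1, i <= j -> index (phi (c i)) p <= index (phi (c j)) p) /\
    (forall i j : 'I_m.+1, i.+1 = j -> index (phi (c j)) p <= (index (phi (c i)) p).+1)].
  move=> sc pc; have [||p [p0 sp up mp [mono st]]] :=
    @contract G (@adj G) (fun i => phi (c (inord i))) m.
  - move=> i im; apply: cons; rewrite /consec sc !pc !inordK ?eqxx //; exact: ltnW.
  - move=> i j k ijk km eik; have [_ cv] := fib _ _ (c (inord j)) eik.
    by apply: cv; rewrite ?sc // !pc !inordK //; move: ijk km; clear; lia.
  exists p; split=> //.
    move=> x; split=> [/mp[i _ ->]|[i ->]]; first by exists (inord i).
    by apply/mp; exists i; rewrite ?inord_val // -ltnS.
  split=> i j ij.
    by have := mono i j; rewrite !inord_val ij -ltnS ltn_ord => /(_ isT).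
  by have := st i; rewrite ij !inord_val -ltnS ltn_ord => /(_ isT).
have [||P [P0 sP uP mP [monoP stP]]] := seg inl.
- by move=> i j; rewrite Udd_same_path.
- by move=> i; rewrite Udd_pos.
have [||Q [Q0 sQ uQ mQ [monoQ stQ]]] := seg inr.
- by move=> i j; rewrite Udd_same_path.
- by move=> i; rewrite Udd_pos.
have disj x : x \in P -> x \in Q -> False.
  move=> /mP[i ->] /mQ[j /fib] /(_ (inl i))[]; by rewrite Udd_same_path.
have l : linkage [:: P; Q].
  rewrite /linkage /= cats0 P0 Q0 sP sQ cat_uniq uP uQ /= andbT.
  by apply/hasPn => x xQ; apply/negP => xP; apply: disj xQ.
have s : spanning [:: P; Q].
  apply/setP => x; rewrite in_set in_setT /= cats0 mem_cat.
  have [[i|i] <-] := surj x; apply/orP; [left|right].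
    by apply/mP; exists i.
  by apply/mQ; exists i.
have inQ := in_Q l s.
have inPP i : phi (inl i) \in P by apply/mP; exists i.
have inQQ i : phi (inr i) \in Q by apply/mQ; exists i.
have ninP i : (phi (inr i) \in P) = false by apply/negbTE; rewrite -inQ.
have posP i : pos P Q (phi (inl i)) = index (phi (inl i)) P by rewrite /pos inPP.
have posQ i : pos P Q (phi (inr i)) = index (phi (inr i)) Q by rewrite /pos ninP.
have neq x y : adj x y -> same_path P x y -> pos P Q x != pos P Q y.
  by move=> xy sxy; apply/eqP => /(pos_inj l s sxy) E; rewrite E adj_irr in xy.
(* An edge within one path lifts to an edge between neighbouring levels, whose images are at most
   one position apart. *)
have nc : no_chord P Q.
  have half x y : adj x y -> same_path P x y ->
      pos P Q x <= pos P Q y <= (pos P Q x).+1 -> consec P Q x y.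
    move=> xy sxy; have := neq x y xy sxy; rewrite /consec sxy /=.
    by clear; lia.
  have half' x y : adj x y -> same_path P x y ->
      pos P Q y <= pos P Q x <= (pos P Q y).+1 -> consec P Q x y.
    move=> xy sxy; have := neq x y xy sxy; rewrite /consec sxy /=.
    by clear; lia.
  move=> x y xy sxy; have [a [b [ea eb]]] := adjE _ _ xy; subst x y.
  case: a b xy sxy => i [] j xy sxy /=.
  - case/orP => /eqP ij; [apply: half|apply: half'] => //; rewrite !posP.
      by rewrite monoP ?stP // -ij.
    by rewrite monoP ?stP // -ij.
  - by move: sxy; rewrite /same_path inPP ninP.
  - by move: sxy; rewrite /same_path inPP ninP.
  - case/orP => /eqP ij; [apply: half|apply: half'] => //; rewrite !posQ.
      by rewrite monoQ ?stQ // -ij.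
    by rewrite monoQ ?stQ // -ij.
exists [:: P; Q]; split=> //; first exact/(chordlessP l s).
move=> /(XX_crossing l s nc)[x1 [x2 [x3 [x4 [y1 [y2 [y3 [y4 []]]]]]]]] /=.
(* Here n is [m.+1] and levels count from 0, so the opposite of level i is m - i. *)
have lift x y : x \in P -> y \in Q -> adj x y ->
    exists i j : 'I_m.+1, [/\ x = phi (inl i), y = phi (inr j) & (i == j) || (i + j == m)].
  move=> xP yQ /adjE[a [b [ea eb]]]; subst x y.
  case: a b xP yQ => i [] j xP yQ /=.
  - by case: (disj _ (inPP j) yQ).
  - move=> h; exists i, j; split=> //; move: h; rewrite -!val_eqE /=; have := ltn_ord j; clear; lia.
  - by case: (disj _ xP (inQQ i)).
  - by case: (disj _ xP (inQQ i)).
case/and5P=> x1P x2P x3P x4P _ /and5P[y1Q y2Q y3Q y4Q _].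
move=> xs ys /and4P[a1 a4 a2 a3].
have [i1 [j2 [ex1 ey2 c1]]] := lift _ _ x1P y2Q a1.
have [i4 [j3 [ex4 ey3 c4]]] := lift _ _ x4P y3Q a4.
have [i2 [j1 [ex2 ey1 c2]]] := lift _ _ x2P y1Q a2.
have [i3 [j4 [ex3 ey4 c3]]] := lift _ _ x3P y4Q a3.
(* Monotonicity reflects strict order, so the crossing in the minor gives one among the levels of
   [Udd n]. *)
have ltP (i j : 'I_m.+1) : index (phi (inl i)) P < index (phi (inl j)) P -> i < j.
  by apply: contraTT; rewrite -!leqNgt => /monoP.
have ltQ (i j : 'I_m.+1) : index (phi (inr i)) Q < index (phi (inr j)) Q -> i < j.
  by apply: contraTT; rewrite -!leqNgt => /monoQ.
rewrite ex1 ex2 ex3 ex4 in xs; rewrite ey1 ey2 ey3 ey4 in ys.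
case/and4P: xs => /ltP x12 /ltP x13 /ltP x24 /ltP x34.
case/and4P: ys => /ltQ y12 /ltQ y13 /ltQ y24 /ltQ y34.
rewrite -!val_eqE /= in c1 c2 c3 c4.
move: (ltn_ord i1) (ltn_ord i4) (ltn_ord j1) (ltn_ord j4).
(* Compare the largest distances to m / 2: that of [i1], [i4] exceeds that of [i2], [i3], which
   equals that of [j1], [j4]; this exceeds that of [j2], [j3], which equals that of [i1], [i4]
   again. *)
by clear - c1 c2 c3 c4 x12 x13 x24 x34 y12 y13 y24 y34; lia.
Qed.

(** * A linkage without crossing is a minor of some [Udd n] *)

Section Sweep.
Variables (s1 : seq nat) (b : nat).
Notation F := (0 :: s1).
Hypothesis pF : path step_le 0 s1.
Hypothesis lF : last 0 s1 = b.

Lemma sweep_mono i j : i <= j -> j < size F -> nth 0 F i <= nth 0 F j.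
Proof.
have sF : sorted leq F by apply: sub_path pF => u v /andP[].
move=> ij jn; apply: (sorted_leq_nth leq_trans leqnn 0 sF) => //.
exact: leq_ltn_trans jn.
Qed.

Lemma sweep_le i : i < size F -> nth 0 F i <= b.
Proof. by rewrite -lF (last_nth 0) => h; apply: sweep_mono => //. Qed.

Lemma sweep_step i : i.+1 < size F -> nth 0 F i <= nth 0 F i.+1 <= (nth 0 F i).+1.
Proof. by move=> h; have /(pathP 0) := pF => /(_ i); apply. Qed.

Lemma sweep_onto k : k <= b -> exists2 i, i < size F & nth 0 F i = k.
Proof. by move=> kb; apply/(nthP 0)/(path_step_hit pF); rewrite lF. Qed.

(** Finds neighbouring levels that realize the path edge between positions [k] and [k.+1]. *)
Lemma sweep_onto2 k : k < b ->
  exists2 i, i.+1 < size F & nth 0 F i = k /\ nth 0 F i.+1 = k.+1.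
Proof.
move=> kb; have pf : path (fun u v => v <= u.+1) 0 s1.
  by apply: sub_path pF => u v /andP[].
have [|u [v [uv <- <-]]] := @cross_step nat id 0 s1 k pf; first by rewrite lF.
have /mem_zip_beheadP[l1 [l2 ->]] : (u, v) \in zip F (behead F) by [].
exists (size l1); first by rewrite size_cat /= !addnS ltnS ltnS leq_addr.
by rewrite !nth_cat ltnn subnn ltnNge leqnSn /= subSnn.
Qed.

End Sweep.

Section Build.
Variables (G : sgraph) (p0 q0 : G) (s t : seq G).
Notation P := (p0 :: s).
Notation Q := (q0 :: t).
Hypothesis lPQ : linkage [:: P; Q].
Hypothesis sPQ : spanning [:: P; Q].
Hypothesis nc : no_chord P Q.
Hypothesis nX : ~ crossing P Q.

(** The sequences from [peel], read as maps from levels to positions, are monotone with steps at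
    most one. So fibres are intervals and path edges are kept or contracted, while the covering
    property of [peel] supplies the rungs. *)
Lemma no_crossing_Truemper : Truemper G.
Proof.
have [_ _ uP uQ] := linkage2 lPQ; have inQ := in_Q lPQ sPQ.
have /andP[/and3P[/andP[_ pP] /andP[_ pQ] _] _] := lPQ.
(* Adjacency between positions; [peel] looks at it only up to [size s] and [size t], where the
   defaults of [nth] do not occur. *)
pose R i j := adj (nth p0 P i) (nth q0 Q j).
have [|s1 [t1 [st [pF lF] [pH lH] cov]]] := @peel R 0 (size s) 0 (size t) (leq0n _) (leq0n _).
  move=> i1 i2 i3 i4 j1 j2 j3 j4 _ i4b _ j4d i12 i13 j12 j13 r1 r4 r2 r3.
  apply: nX.
  exists (nth p0 P i1), (nth p0 P i2), (nth p0 P i3), (nth p0 P i4).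
  exists (nth q0 Q j1), (nth q0 Q j2), (nth q0 Q j3), (nth q0 Q j4).
  have iP : [/\ i1 < size P, i2 < size P, i3 < size P & i4 < size P].
    by rewrite /=; split; move: i4b i12 i13; clear; lia.
  have jQ : [/\ j1 < size Q, j2 < size Q, j3 < size Q & j4 < size Q].
    by rewrite /=; split; move: j4d j12 j13; clear; lia.
  case: iP jQ => [h1 h2 h3 h4] [k1 k2 k3 k4].
  rewrite /R in r1 r2 r3 r4; split.
  - by apply/and5P; split=> //; exact: mem_nth.
  - by apply/and5P; split=> //; exact: mem_nth.
  - by rewrite !index_uniq //; case/andP: i12 => -> ->; case/andP: i13 => -> ->.
  - by rewrite !index_uniq //; case/andP: j12 => -> ->; case/andP: j13 => -> ->.
  - by apply/and4P.
set F := 0 :: s1 in cov; set H := 0 :: t1 in cov.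
have FH : size F = size H by rewrite /= st.
pose n := size F.
pose phi (x : Udd n) : G :=
  match x with inl i => nth p0 P (nth 0 F i) | inr i => nth q0 Q (nth 0 H i) end.
have n0 : 0 < n by [].
have phiL i (h : i < n) : phi (inl (Ordinal h)) = nth p0 P (nth 0 F i) by [].
have phiR i (h : i < n) : phi (inr (Ordinal h)) = nth q0 Q (nth 0 H i) by [].
have ltF i : i < n -> nth 0 F i < size P by move=> h; rewrite ltnS (sweep_le pF lF).
have ltH i : i < n -> nth 0 H i < size Q.
  by rewrite /n FH => h; rewrite ltnS (sweep_le pH lH).
have FP (i : 'I_n) : nth p0 P (nth 0 F i) \in P by rewrite mem_nth ?ltF.
have HQ (i : 'I_n) : nth q0 Q (nth 0 H i) \in Q by rewrite mem_nth ?ltH.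
have stepP i : i.+1 < size P -> adj (nth p0 P i) (nth p0 P i.+1).
  by move=> h; have /(pathP p0) := pP; apply.
have stepQ i : i.+1 < size Q -> adj (nth q0 Q i) (nth q0 Q i.+1).
  by move=> h; have /(pathP q0) := pQ; apply.
exists n; split=> //; exists phi.
apply/(linkage_minorP (Udd_linkageP n0) (@Udd_spanning n) _ (@Udd_no_chord n)).
have lift_nc h k : adj h k -> same_path P h k -> (pos P Q h).+1 = pos P Q k ->
    exists x y, [/\ phi x = h, phi y = k & adj x y].
  rewrite /same_path /pos => _ /eqP kP; rewrite -kP; have [hP|hP] := boolP (h \in P) => hk.
    rewrite hP in kP; have lt : index h P < size s.
      by rewrite -ltnS -[(size s).+1]/(size P) hk index_mem -kP.
    have [i i_n [Fi Fi1]] := sweep_onto2 pF lF lt.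
    exists (inl (Ordinal (ltnW i_n : i < n))), (inl (Ordinal (i_n : i.+1 < n))).
    by rewrite !phiL Fi Fi1 hk !nth_index -?kP //= eqxx.
  rewrite (negPf hP) in kP; have hQ : h \in Q by rewrite inQ.
  have kQ : k \in Q by rewrite inQ -kP.
  have lt : index h Q < size t.
    by rewrite -ltnS -[(size t).+1]/(size Q) hk index_mem.
  have [i i_n [Fi Fi1]] := sweep_onto2 pH lH lt.
  have i_n' : i.+1 < n by rewrite /n FH.
  exists (inr (Ordinal (ltnW i_n' : i < n))), (inr (Ordinal i_n')).
  by rewrite !phiR Fi Fi1 hk !nth_index //= eqxx.
split.
- move=> x; have [xP|xP] := boolP (x \in P).
    have xb : index x P <= size s by rewrite -ltnS -[(size s).+1]/(size P) index_mem.
    have [i i_n Fi] := sweep_onto pF lF xb.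
    by exists (inl (Ordinal (i_n : i < n))); rewrite phiL Fi nth_index.
  have xQ : x \in Q by rewrite inQ.
  have xb : index x Q <= size t by rewrite -ltnS -[(size t).+1]/(size Q) index_mem.
  have [i i_n Fi] := sweep_onto pH lH xb; rewrite -FH in i_n.
  by exists (inr (Ordinal (i_n : i < n))); rewrite phiR Fi nth_index.
- move=> x y z; rewrite !Udd_same_path !Udd_pos; case: x y => i [] j /= E.
  + split=> //; case: z => k //= _ /andP[ik kj]; congr nth.
    move/eqP: E; rewrite nth_uniq ?ltF // => /eqP E.
    have := sweep_mono pF ik (ltn_ord k); have := sweep_mono pF kj (ltn_ord j).
    by rewrite -/F; move: E; clear; lia.
  + by have := HQ j; rewrite -E inQ FP.
  + by have := HQ i; rewrite E inQ FP.
  + split=> //; case: z => k //= _ /andP[ik kj]; congr nth.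
    move/eqP: E; rewrite nth_uniq ?ltH // => /eqP E.
    have kn : k < size H by rewrite -FH.
    have jn : j < size H by rewrite -FH.
    have := sweep_mono pH ik kn; have := sweep_mono pH kj jn.
    by rewrite -/H; move: E; clear; lia.
- have half x y : same_path (Uu n) x y ->
      (pos (Uu n) (Uv n) x).+1 = pos (Uu n) (Uv n) y ->
      phi x = phi y \/ adj (phi x) (phi y).
    rewrite Udd_same_path !Udd_pos; case: x y => i [] j //= _ ij.
      have jn : j < size F by [].
      have := sweep_step pF (i := i); rewrite -/F ij => /(_ jn).
      have := stepP (nth 0 F i); have := ltF j jn.
      have [->|ne] := eqVneq (nth 0 F j) (nth 0 F i); first by left.
      move=> lt sP' le; right; have e : nth 0 F j = (nth 0 F i).+1 by move: le ne; clear; lia.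
      by rewrite e; apply: sP'; rewrite -e.
    have jn : j < size H by rewrite -FH.
    have := sweep_step pH (i := i); rewrite -/H ij => /(_ jn).
    have := stepQ (nth 0 H i); have := ltH j (ltn_ord j).
    have [->|ne] := eqVneq (nth 0 H j) (nth 0 H i); first by left.
    move=> lt sP' le; right; have e : nth 0 H j = (nth 0 H i).+1 by move: le ne; clear; lia.
    by rewrite e; apply: sP'; rewrite -e.
  move=> x y /andP[sxy /orP[] /eqP e]; first exact: half.
  by rewrite adj_sym; case: (half y x); rewrite // 1?same_pathC //; auto.
have liftR x y : x \in P -> y \in Q -> adj x y ->
    exists i j : 'I_n, [/\ phi (inl i) = x, phi (inr j) = y & adj (inl i : Udd n) (inr j)].
  move=> xP yQ xy.
  have xb : 0 <= index x P <= size s by rewrite leq0n -ltnS -[(size s).+1]/(size P) index_mem.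
  have yb : 0 <= index y Q <= size t by rewrite leq0n -ltnS -[(size t).+1]/(size Q) index_mem.
  have := cov _ _ xb yb; rewrite /R !nth_index // => /(_ xy).
  rewrite mem_cat => /orP[] /(nthP (0, 0)) [k].
    rewrite size_zip FH minnn nth_zip // => kn [ex ey].
    have kn' : k < n by rewrite /n FH.
    exists (Ordinal kn'), (Ordinal kn'); rewrite [adj _ _]/= eqxx phiL phiR ex ey.
    by split=> //; exact: nth_index.
  rewrite size_zip size_rev FH minnn nth_zip ?size_rev // => kn [ex].
  rewrite nth_rev // => ey; have kn' : k < n by rewrite /n FH.
  exists (Ordinal kn'), (rev_ord (Ordinal kn')).
  rewrite [adj _ _]/= rev_ordK eqxx orbT phiL ex [phi _]/=.
  by rewrite /n FH ey; split=> //; exact: nth_index.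
move=> h k hk.
have [hkP|] := boolP (same_path P h k).
  have /andP[_ /orP[] /eqP e] := nc hk hkP; first exact: lift_nc.
  have [||| y [x [? ? ?]]] := lift_nc k h; rewrite 1?adj_sym 1?same_pathC //.
  by exists x, y; rewrite adj_sym.
rewrite /same_path; have [hP|hP] := boolP (h \in P).
  rewrite eq_sym eqb_id -inQ => kQ.
  by have [i [j [ei ej ij]]] := liftR h k hP kQ hk; exists (inl i), (inr j).
rewrite -inQ in hP; rewrite eq_sym eqbF_neg negbK => kP.
have kh : adj k h by rewrite adj_sym.
have [i [j [ei ej ij]]] := liftR k h kP hP kh.
by exists (inr j), (inl i); rewrite adj_sym.
Qed.

End Build.

(** * Assembling the equivalences *)

Lemma two_components (G : sgraph) (L : seq (seq G)) :
  linkage L -> size L = 2 -> exists p0 s q0 t, L = [:: p0 :: s; q0 :: t].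
Proof.
case: L => [|[|p0 s] [|[|q0 t] []]] //; rewrite /linkage /= ?andbF //.
by exists p0, s, q0, t.
Qed.

Theorem theorem1p2 (G : sgraph) :
  ((exists L : seq (seq G), [/\ linkage L, size L = 2 & vital L]) <->
   (exists L : seq (seq G),
      [/\ linkage L, size L = 2, spanning L, chordless L & ~ has_XX L]))
  /\
  ((exists L : seq (seq G),
      [/\ linkage L, size L = 2, spanning L, chordless L & ~ has_XX L]) <->
   Truemper G).
Proof.
split; split; last exact: Truemper_no_XX.
- move=> [L [l /(two_components l)[p0 [s [q0 [t eL]]]] [u sp]]]; subst L.
  have nc := vital_no_chord l sp u; exists [:: p0 :: s; q0 :: t]; split=> //.
    exact/(chordlessP l sp).
  by move=> /(XX_crossing l sp nc); apply: vital_no_crossing.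
- move=> [L [l /(two_components l)[p0 [s [q0 [t eL]]]] sp]]; subst L.
  move=> /(chordlessP l sp) nc nX; exists [:: p0 :: s; q0 :: t]; split=> //.
  by split=> //; apply: no_crossing_unique => // /(crossing_XX l sp nc).
- move=> [L [l /(two_components l)[p0 [s [q0 [t eL]]]] sp]]; subst L.
  move=> /(chordlessP l sp) nc nX.
  by apply: (no_crossing_Truemper l sp nc) => /(crossing_XX l sp nc).
Qed.
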